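(* Let $\prec$ be an exposure order on $F$ and let $I\lneqq\mathcal{A}=K[F]$ be a proper right ideal. The Gröbner basis $B_{I,\prec}^{\mathrm{gr}}$ is a combinatorially reducing system for $I$ with respect to $\prec$.
   Context: $K$ is a field, $F$ is a free group with finite basis $S$ (elements are reduced words in $S\cup S^{-1}$; $e$ is the identity), and $\mathcal{A}=K[F]$. The support $\mathrm{supp}(f)$ of $f\in\mathcal{A}$ is the set of words with nonzero coefficient in $f$; $f$ is supported on $T\subseteq F$ if $\mathrm{supp}(f)\subseteq T$. $\mathrm{Sp}_K(T)$ is the $K$-span of $T$. ''Ideal'' means right ideal. An exposure order on $F$ is a well-order $\prec$ on $F$ such that $u\preceq v$ whenever $u$ is a prefix of $v$. For distinct subsets $A,B\subseteq F$: $A\prec_{\min}B$ if $\min(A\triangle B)\in A$ (a total order on subsets). For distinct finite subsets: $A\prec_{\max}B$ if $\max(A\triangle B)\in B$ (a well-order on finite subsets). For $0\ne f\in\mathcal{A}$, the head term $\mathrm{HT}(f)$ is the $\prec$-maximal word in $\mathrm{supp}(f)$; $f$ is monic if the coefficient of $\mathrm{HT}(f)$ in $f$ is $1$. For $f\in\mathcal{A}\setminus K$, the head term tail $\mathrm{HTT}(f)\in S\cup S^{-1}$ is the last letter of $\mathrm{HT}(f)$. A Schreier transversal for $I$ is a prefix-closed subset $T\subseteq F$ such that $\mathrm{Sp}_K(T)\cap I=\{0\}$ and every $I$-coset in $\mathcal{A}$ intersects $\mathrm{Sp}_K(T)$. The set of Schreier transversals for $I$ has a $\prec_{\min}$-minimum,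 denoted $T_I=T_{I,\prec}$. $\phi_I:\mathcal{A}\to\mathrm{Sp}_K(T_I)$ sends $f$ to the unique element of $f+I$ supported on $T_I$. A prefix-neighbor of a prefix-closed set $T$ is a word not in $T$ all of whose proper prefixes lie in $T$; $\partial T$ is the set of prefix-neighbors of $T$. Exposure process of $I$: define $f_\alpha\in I$ by transfinite recursion. Given $f_\beta$ for all $\beta<\alpha$, let $I_\alpha$ be the right ideal generated by $\{f_\beta:\beta<\alpha\}$. If $I_\alpha=I$, stop and set $\omega_I:=\alpha$. Otherwise let $f_\alpha$ be the unique monic element of $I$ whose support is $\prec_{\max}$-minimal among the monic elements of $I$ supported on $T_{I_\alpha}$ (it exists and is unique, and the process always stops). For $I\ne\mathcal{A}$ and $\alpha<\omega_I$, let $b_\alpha=\mathrm{HTT}(f_\alpha)$ and let the second $s_\alpha$ of $f_\alpha$ be the monic $K^\times$-multiple of $\phi_{I_\alpha}(f_\alpha b_\alpha^{-1})$ (which is nonzero). The Gröbner basis of $I$ is $B_{I,\prec}^{\mathrm{gr}}=\{f_\alpha\}_{\alpha<\omega_I}\cup\{s_\alpha\}_{\alpha<\omega_I}$. For a set $\mathcal{Q}$ of monic elements of $\mathcal{A}\setminus K$, let $T_{\mathcal{Q}}^{\mathrm{HT}}$ be the set of words in $F$ that do not have any $\mathrm{HT}(q)$, $q\in\mathcal{Q}$, as a prefix. $\mathcal{Q}$ is a combinatorially reducing system (CRS) with respect to $\prec$ if: (1) the head terms $(\mathrm{HT}(q))_{q\in\mathcal{Q}}$ are distinct; (2) for each $q\in\mathcal{Q}$,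 letting $b=\mathrm{HTT}(q)$, the element $qb^{-1}$ is a $K$-linear combination of elements $h\in\mathcal{Q}$ with $\mathrm{HTT}(h)=b^{-1}$; (3) each $q\in\mathcal{Q}$ is supported on $T_{\mathcal{Q}}^{\mathrm{HT}}\cup\partial T_{\mathcal{Q}}^{\mathrm{HT}}$. It is a CRS for $I$ if moreover it generates $I$ as a right ideal. *)

(* Defs.v *)
From HB Require Import structures.
From mathcomp Require Import all_boot all_order all_algebra monoid finmap.
From mathcomp.multinomials Require Import monalg.
From mathcomp Require Import boolp classical_sets wochoice.

Set Implicit Arguments.
Unset Strict Implicit.
Unset Printing Implicit Defensive.

Import GRing.Theory.

Local Open Scope classical_set_scope.
Local Open Scope ring_scope.

(* A letter (s, false) is the generator s, and (s, true) is its inverse.      *)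
Definition letter (S : finType) : Type := (S * bool)%type.

HB.instance Definition _ (S : finType) := Finite.on (letter S).

Definition linv (S : finType) (a : letter S) : letter S := (a.1, ~~ a.2).

Definition reduced (S : finType) (w : seq (letter S)) : bool :=
  sorted (fun a b => b != linv a) w.

Record free_group (S : finType) : predArgType :=
  FreeWord { word_of :> seq (letter S); _ : reduced word_of }.

Arguments FreeWord {S} word_of _.

HB.instance Definition _ (S : finType) := [isSub for @word_of S].
HB.instance Definition _ (S : finType) := [Countable of free_group S by <:].

Section FreeGroup.
Variable S : finType.
Implicit Types (a b : letter S) (s t w : seq (letter S)) (u v : free_group S).

Lemma linvK : involutive (@linv S).
Proof. by case=> x b; rewrite /linv /= negbK. Qed.

Definition lmul a w : seq (letter S) :=
  if w is b :: w' then if b == linv a then w' else a :: w else [:: a].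

Definition wmul s t : seq (letter S) := foldr lmul t s.

Definition winv s : seq (letter S) := rev (map (@linv S) s).

Lemma reduced_behead a w : reduced (a :: w) -> reduced w.
Proof. by rewrite /reduced /=; apply: path_sorted. Qed.

Lemma reduced_drop n w : reduced w -> reduced (drop n w).
Proof. by move=> rw; apply: drop_sorted. Qed.

Lemma reduced_lmul a w : reduced w -> reduced (lmul a w).
Proof.
case: w => [|b w] //= rw; case: eqP => [_|/eqP nba].
  exact: reduced_behead rw.
by rewrite /reduced /= nba.
Qed.

Lemma reduced_wmul s t : reduced t -> reduced (wmul s t).
Proof. by elim: s => //= a s IHs /IHs; apply: reduced_lmul. Qed.

Lemma reduced_winv s : reduced s -> reduced (winv s).
Proof.
rewrite /reduced /winv rev_sorted sorted_map; apply: sub_sorted => a b /=.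
by rewrite /relpre /= linvK eq_sym (inv_eq linvK).
Qed.

Lemma lmulK a w : reduced w -> lmul (linv a) (lmul a w) = w.
Proof.
case: w => [|b w] /=; first by rewrite linvK eqxx.
case: eqP => [->|_] rw /=; last by rewrite linvK eqxx.
case: w rw => [|c w] //=; rewrite /reduced /= => /andP[].
by rewrite linvK => /negPf->.
Qed.

Lemma lmulVK a w : reduced w -> lmul a (lmul (linv a) w) = w.
Proof. by move=> rw; rewrite -{1}[a]linvK lmulK. Qed.

Lemma wmul_lmul a s t : reduced t -> wmul (lmul a s) t = lmul a (wmul s t).
Proof.
case: s => [|b s] //= rt; case: eqP => // ->.
by rewrite lmulVK // reduced_wmul.
Qed.

Lemma wmulA s t w : reduced w -> wmul s (wmul t w) = wmul (wmul s t) w.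
Proof. by move=> rw; elim: s => //= a s ->; rewrite wmul_lmul. Qed.

Lemma wmul_nil s : reduced s -> wmul s [::] = s.
Proof.
elim: s => //= a s IHs rs; rewrite IHs ?(reduced_behead rs) //.
by case: s rs {IHs} => //= b s; rewrite /reduced /= => /andP[/negPf->].
Qed.

Lemma wmul_cat s t w : wmul (s ++ t) w = wmul s (wmul t w).
Proof. by rewrite /wmul foldr_cat. Qed.

Lemma wmulV s : wmul (winv s) s = [::].
Proof.
elim: s => //= a s IHs; rewrite /winv /= rev_cons -cats1 wmul_cat /=.
by rewrite linvK eqxx.
Qed.

Lemma winvK s : winv (winv s) = s.
Proof. by rewrite /winv map_rev revK mapK //; apply: linvK. Qed.

Lemma word_reduced u : reduced u. Proof. by case: u. Qed.

Definition fg1 : free_group S := FreeWord [::] isT.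
Definition fg_mul u v : free_group S :=
  FreeWord (wmul u v) (reduced_wmul u (word_reduced v)).
Definition fg_inv u : free_group S :=
  FreeWord (winv u) (reduced_winv (word_reduced u)).

Lemma fg_mulA : associative fg_mul.
Proof. by move=> u v w; apply/val_inj/wmulA/word_reduced. Qed.

Lemma fg_mul1 : left_id fg1 fg_mul.
Proof. by move=> u; apply/val_inj. Qed.

Lemma fg_mulr1 : right_id fg1 fg_mul.
Proof. by move=> u; apply/val_inj/wmul_nil/word_reduced. Qed.

Lemma fg_mulV : left_inverse fg1 fg_inv fg_mul.
Proof. by move=> u; apply/val_inj/wmulV. Qed.

Lemma fg_mulrV : right_inverse fg1 fg_inv fg_mul.
Proof. by move=> u; apply/val_inj; rewrite /= -{1}[word_of u]winvK wmulV. Qed.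

HB.instance Definition _ := isGroup.Build (free_group S)
  fg_mulA fg_mul1 fg_mulr1 fg_mulV fg_mulrV.

Definition last_letter u : free_group S :=
  FreeWord (drop (size u).-1 u) (reduced_drop (size u).-1 (word_reduced u)).

End FreeGroup.

(* The library's ring structure on {malg K[G]} requires a monoid G in which   *)
(* only 1 is invertible, hence the alias with its own convolution product.    *)
Definition group_algebra (K : fieldType) (G : groupType) : Type := {malg K[G]}.

HB.instance Definition _ (K : fieldType) (G : groupType) :=
  GRing.Lmodule.on (group_algebra K G).

Section GroupAlgebra.
Variables (K : fieldType) (G : groupType).
Local Notation A := (group_algebra K G).
Implicit Types (f g h : A) (u v w : G) (c : K).

Definition of_group w : A := << 1 *g w >>.

Definition ga_mul f g : A :=
  \sum_(u <- msupp f) \sum_(v <- msupp g) << f@_u * g@_v *g (u * v)%g >>.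

Lemma ga_mulw (d1 d2 : {fset G}) f g :
  (msupp f `<=` d1)%fset -> (msupp g `<=` d2)%fset ->
  ga_mul f g = \sum_(u <- d1) \sum_(v <- d2) << f@_u * g@_v *g (u * v)%g >>.
Proof.
move=> le1 le2; rewrite /ga_mul (big_fset_incl _ le1) /=.
  apply/eq_bigr=> u _; apply/big_fset_incl => // v _ /mcoeff_outdom ->.
  by rewrite mulr0 monalgU0.
move=> u _ /mcoeff_outdom fu.
by rewrite big1 // => v _; rewrite fu mul0r monalgU0.
Qed.

Lemma ga_mul0l : left_zero 0 ga_mul.
Proof. by move=> g; rewrite /ga_mul msupp0 big_seq_fset0. Qed.

Lemma ga_mul0r : right_zero 0 ga_mul.
Proof.
by move=> g; rewrite /ga_mul big1 // => u _; rewrite msupp0 big_seq_fset0.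
Qed.

Lemma ga_mulDl : left_distributive ga_mul +%R.
Proof.
move=> f g h; have sr := fsubset_refl (msupp h).
rewrite (ga_mulw (msuppD_le f g) sr) (ga_mulw (fsubsetUl _ (msupp g)) sr).
rewrite (ga_mulw (fsubsetUr (msupp f) _) sr) -big_split /=; apply/eq_bigr=> u _.
rewrite -big_split /=; apply/eq_bigr=> v _.
by rewrite mcoeffD mulrDl monalgUD.
Qed.

Lemma ga_mulDr : right_distributive ga_mul +%R.
Proof.
move=> h f g; have sr := fsubset_refl (msupp h).
rewrite (ga_mulw sr (msuppD_le f g)) (ga_mulw sr (fsubsetUl _ (msupp g))).
rewrite (ga_mulw sr (fsubsetUr (msupp f) _)) -big_split /=; apply/eq_bigr=> u _.
rewrite -big_split /=; apply/eq_bigr=> v _.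
by rewrite mcoeffD mulrDr monalgUD.
Qed.

Lemma ga_mulUU c1 c2 u v :
  ga_mul << c1 *g u >> << c2 *g v >> = << c1 * c2 *g (u * v)%g >>.
Proof. by rewrite (ga_mulw msuppU_le msuppU_le) !big_seq_fset1 !mcoeffUU. Qed.

Lemma ga_mul_suml (T : Type) (r : seq T) (F : T -> A) g :
  ga_mul (\sum_(i <- r) F i) g = \sum_(i <- r) ga_mul (F i) g.
Proof.
exact: (big_morph (ga_mul^~ g) (fun x y => ga_mulDl x y g) (ga_mul0l g)).
Qed.

Lemma ga_mul_sumr (T : Type) (r : seq T) (F : T -> A) f :
  ga_mul f (\sum_(i <- r) F i) = \sum_(i <- r) ga_mul f (F i).
Proof. exact: (big_morph (ga_mul f) (ga_mulDr f) (ga_mul0r f)). Qed.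

Lemma ga_mulA : associative ga_mul.
Proof.
move: ga_mul ga_mul_suml ga_mul_sumr ga_mulUU => m suml sumr mUU f g h.
rewrite [f]monalgE [g]monalgE [h]monalgE.
rewrite !suml; apply: eq_bigr => u _.
rewrite sumr [X in m X _]sumr suml; apply: eq_bigr => v _.
rewrite !sumr; apply: eq_bigr => w _.
by rewrite !mUU mulrA mulgA.
Qed.

Lemma ga_mul1l : left_id (of_group 1%g) ga_mul.
Proof.
move=> f; rewrite [f in LHS]monalgE [RHS]monalgE ga_mul_sumr.
by apply: eq_bigr => u _; rewrite ga_mulUU mul1r mul1g.
Qed.

Lemma ga_mul1r : right_id (of_group 1%g) ga_mul.
Proof.
move=> f; rewrite [f in LHS]monalgE [RHS]monalgE ga_mul_suml.
by apply: eq_bigr => u _; rewrite ga_mulUU mulr1 mulg1.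
Qed.

Lemma ga_1neq0 : of_group 1%g != 0.
Proof. by rewrite monalgU_eq0 oner_eq0. Qed.

HB.instance Definition _ := GRing.Zmodule_isNzRing.Build A
  ga_mulA ga_mul1l ga_mul1r ga_mulDl ga_mulDr ga_1neq0.

Lemma ga_scaleE c f : c *: f = (<< c *g (1 : G)%g >> : A) * f.
Proof.
rewrite [f]monalgE scaler_sumr [RHS]ga_mul_sumr; apply: eq_bigr => u _.
rewrite ga_mulUU mul1g; apply/malgP => k.
by rewrite mcoeffZ !mcoeffU mulrnAr.
Qed.

Lemma ga_scaleAl c f g : c *: (f * g) = (c *: f) * g.
Proof. by rewrite !ga_scaleE mulrA. Qed.

HB.instance Definition _ := GRing.Lmodule_isLalgebra.Build K A ga_scaleAl.

Lemma ga_scaleAr c f g : c *: (f * g) = f * (c *: g).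
Proof.
rewrite !ga_scaleE mulrA [RHS]mulrA; congr (_ * g).
rewrite [f]monalgE mulr_sumr mulr_suml; apply: eq_bigr => u _.
by rewrite [LHS]ga_mulUU [RHS]ga_mulUU mul1g mulg1 mulrC.
Qed.

HB.instance Definition _ := GRing.Lalgebra_isAlgebra.Build K A ga_scaleAr.

Definition supp f : set G := [set w | w \in msupp f].

Definition supported_on f (T : set G) : Prop := supp f `<=` T.

Definition lin_span (X : set A) : set A :=
  [set f | exists (n : nat) (c : 'I_n -> K) (x : 'I_n -> A),
     (forall i, X (x i)) /\ f = \sum_(i < n) c i *: x i].

Definition Sp (T : set G) : set A := lin_span (of_group @` T).

Definition right_ideal (I : set A) : Prop :=
  [/\ I 0, forall f g, I f -> I g -> I (f + g) & forall f a, I f -> I (f * a)].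

Definition right_ideal_gen (X : set A) : set A := smallest right_ideal X.

Definition ideal_coset (I : set A) f : set A := [set g | I (g - f)].

End GroupAlgebra.

Arguments of_group K {G} w.
Arguments Sp K {G} T.

Section Words.
Variable S : finType.
Local Notation F := (free_group S).
Implicit Types (u v w : F) (T : set F).

Definition prefix_closed T : Prop := forall u v, prefix u v -> T v -> T u.

Definition prefix_neighbors T : set F :=
  [set w | ~ T w /\ forall u, prefix u w -> u != w -> T u].

Variable le : rel F.

Definition exposure_order : Prop :=
  well_order le /\ forall u v, prefix u v -> le u v.

Definition is_min T w : Prop := T w /\ forall u, T u -> le w u.

Definition is_max T w : Prop := T w /\ forall u, T u -> le u w.

(* Either relation implies T1 <> T2; lt_max is used on finite sets only. *)
Definition lt_min T1 T2 : Prop := exists w, is_min (T1 `+` T2) w /\ T1 w.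

Definition lt_max T1 T2 : Prop := exists w, is_max (T1 `+` T2) w /\ T2 w.

End Words.

Section Groebner.
Variables (K : fieldType) (S : finType) (le : rel (free_group S)).
Local Notation F := (free_group S).
Local Notation A := (group_algebra K F).
Implicit Types (f g h q s : A) (u v w : F) (T : set F) (I J : set A).

(* HT 0 = 1 is a default value, irrelevant to the definitions below. *)
Definition HT f : F := xget 1%g [set w | is_max le (supp f) w].

Definition HC f : K := f@_(HT f).

Definition is_monic f : Prop := f != 0 /\ HC f = 1.

Definition monic_multiple f : A := (HC f)^-1 *: f.

Definition nonconstant f : Prop := ~ exists c : K, f = c%:A.

(* The head term tail is a letter, seen as a word of length one. *)
Definition HTT f : F := last_letter (HT f).

Definition schreier_transversal I T : Prop :=
  [/\ prefix_closed T,
      Sp K T `&` I = [set 0] &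
      forall f, ideal_coset I f `&` Sp K T !=set0].

Definition is_min_transversal I T : Prop :=
  schreier_transversal I T /\
  forall T', schreier_transversal I T' -> T' <> T -> lt_min le T T'.

Definition min_transversal I : set F := xget set0 (is_min_transversal I).

Definition phi I f : A :=
  xget 0 [set g | ideal_coset I f g /\ supported_on g (min_transversal I)].

Definition exposed_candidate I J f : Prop :=
  [/\ I f, is_monic f & supported_on f (min_transversal J)].

(* [is_exposed I I_alpha f] holds for exactly one f, namely f_alpha. *)
Definition is_exposed I J f : Prop :=
  exposed_candidate I J f /\
  forall g, exposed_candidate I J g -> ~ lt_max le (supp g) (supp f).

Definition second J f : A :=
  monic_multiple (phi J (f * of_group K (HTT f)^-1%g)).

(* The ideal I_alpha, for a family f indexed by a type W ordered by leW. *)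
Definition stage (W : eqType) (leW : rel W) (f : W -> A) (a : W) : set A :=
  right_ideal_gen [set f b | b in [set b | leW b a /\ b <> a]].

(* The ordinal omega_I is represented by a well-ordered type W: the family f  *)
(* satisfies the recursion at each a in W, where the process has not stopped, *)
(* and the process stops at the end of W.                                     *)
Definition exposure_process I (W : eqType) (leW : rel W) (f : W -> A) : Prop :=
  [/\ well_order leW,
      forall a, stage leW f a <> I /\ is_exposed I (stage leW f a) (f a) &
      right_ideal_gen (range f) = I].

(* The exposure process of I exists and is unique up to an isomorphism of its *)
(* index set, which does not affect the elements f_alpha and s_alpha.         *)
Definition groebner_basis I : set A :=
  [set q | exists (W : eqType) (leW : rel W) (f : W -> A),
     exposure_process I leW f /\
     exists a, q = f a \/ q = second (stage leW f a) (f a)].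

Definition T_HT (Q : set A) : set F :=
  [set w | forall q, Q q -> ~~ prefix (HT q) w].

Record is_CRS (Q : set A) : Prop := {
  CRS_monic : forall q, Q q -> is_monic q /\ nonconstant q;
  CRS_inj : forall q1 q2, Q q1 -> Q q2 -> HT q1 = HT q2 -> q1 = q2;
  CRS_span : forall q, Q q ->
    lin_span [set h | Q h /\ HTT h = (HTT q)^-1%g]
      (q * of_group K (HTT q)^-1%g);
  CRS_supp : forall q, Q q ->
    supported_on q (T_HT Q `|` prefix_neighbors (T_HT Q)) }.

Definition is_CRS_for I (Q : set A) : Prop :=
  is_CRS Q /\ right_ideal_gen Q = I.

End Groebner.

(* Main.v *)
Require Import Defs.
From HB Require Import structures.
From mathcomp Require Import all_boot all_order all_algebra monoid finmap.
From mathcomp.multinomials Require Import monalg.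
From mathcomp Require Import boolp classical_sets wochoice.

(* Let T be the minimal Schreier transversal of I and, for a letter a, let V_a *)
(* be the space of elements of I supported on T and on the prefix-neighbors   *)
(* of T ending in a. Right multiplication by the inverse of a maps V_a onto   *)
(* V_(a^-1), and each prefix-neighbor w of T is the head of an element g_w of *)
(* some V_a, with g_w - w supported on words of T smaller than w.             *)
(*   If a family of subspaces R_a of V_a is stable under these flips, and J is *)
(* the right ideal that it generates, then the words without a prefix in the  *)
(* set D of heads of the R_a form the minimal transversal of J: rewriting the *)
(* heads in D makes F act on the span of those words, and J annihilates 1 in  *)
(* this action. In particular J meets V_a in R_a only.                        *)
(*   This applies to every stage J of the exposure process. The next exposed  *)
(* element is g_w for the least prefix-neighbor w of T that is not in D, and  *)
(* its second is the reduction modulo J of g_w a^-1, an element of V_(a^-1).  *)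
(* By transfinite induction the elements produced so far span the traces of J *)
(* on the V_a, and at the end they span the V_a themselves, with distinct     *)
(* heads that exhaust the prefix-neighbors of T.                              *)

(** The rewriting argument culminates in [generated_ideal_reduced]; its two consequences
    [generated_ideal_transversal] and [generated_ideal_edge_space] turn it into control of the
    stages. [exposedE] and [secondP] then identify the exposed element and its second, and
    [trace_output_span_step] is the inductive step showing that the outputs span the traces. The
    conditions of a CRS follow from the spanning statement for the whole process. Heads are distinct
    because an output avoids the heads of all earlier stages ([outputs_HT_inj]). The outputs whose
    head ends in a span V_a, so every prefix-neighbor of T is a head and [T_HT] of the outputs is T
    ([outputs_T_HT]); the support condition then merely says that outputs lie in some V_a, and the
    condition on q b^-1 says that the flip of q lies in V_(b^-1), which the outputs span. Since
    [groebner_basis] collects the outputs of all processes, one also needs that a process exists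
    ([exposure_process_exists]) and that any two have the same elements ([process_simulation]);
    [groebner_basisE] then reduces everything to one fixed process. *)

Set Implicit Arguments.
Unset Strict Implicit.
Unset Printing Implicit Defensive.

Import GRing.Theory.

Local Open Scope classical_set_scope.
Local Open Scope ring_scope.

(** * Well-orders *)

Section WellOrder.
Variables (T : eqType) (R : rel T).
Hypothesis woR : well_order R.
Implicit Types (x y z : T) (X : set T).

(** [well_order] provides unique minima of nonempty predicates and nothing else. Totality,
    antisymmetry and transitivity are extracted below by minimising over sets of two or three
    elements. *)
Lemma wo_min X : X !=set0 -> exists2 x, X x & forall y, X y -> R x y.
Proof.
case=> x0 Xx0; have [|x [[xX minx] _]] := woR (A := [pred x | `[< X x >]]).
  by exists x0; apply/asboolP.
by exists x => [|y Xy]; [apply/asboolP | apply/minx/asboolP].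
Qed.

Lemma wo_total x y : R x y || R y x.
Proof.
have [|z zxy minz] := @wo_min [set z | z = x \/ z = y]; first by exists x; left.
by case: zxy minz => -> minz; rewrite minz ?orbT //; [right | left].
Qed.

Lemma wo_refl x : R x x.
Proof. by have := wo_total x x; rewrite orbb. Qed.

Lemma wo_anti x y : R x y -> R y x -> x = y.
Proof.
move=> xy yx; have [|z [_ uniqz]] := woR (A := [pred z | (z == x) || (z == y)]).
  by exists x; rewrite inE eqxx.
rewrite -(uniqz x) ?(uniqz y) //; split; rewrite ?inE ?eqxx ?orbT //.
  by move=> w; rewrite inE => /orP[]/eqP->; rewrite // wo_refl.
by move=> w; rewrite inE => /orP[]/eqP->; rewrite // wo_refl.
Qed.

Lemma wo_trans y x z : R x y -> R y z -> R x z.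
Proof.
move=> xy yz.
have [|w wxyz minw] := @wo_min [set w | [\/ w = x, w = y | w = z]].
  by exists x; constructor.
have wx : R w x by apply: minw; constructor 1.
have wy : R w y by apply: minw; constructor 2.
have wz : R w z by apply: minw; constructor 3.
by case: wxyz => ew; rewrite ew in wx wy wz => //;
  [rewrite (wo_anti xy wx) | rewrite -(wo_anti yz wy)].
Qed.

Definition wo_lt x y : Prop := R x y /\ x <> y.

Lemma wo_ltNge x y : wo_lt x y <-> ~ R y x.
Proof.
split=> [[xy ne] yx|nyx]; first exact/ne/wo_anti.
split; first by case/orP: (wo_total x y).
by move=> exy; apply: nyx; rewrite exy wo_refl.
Qed.

Lemma wo_lt_le_trans y x z : wo_lt x y -> R y z -> wo_lt x z.
Proof.
move=> /wo_ltNge nyx yz; apply/wo_ltNge => zx; apply: nyx.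
exact: wo_trans yz zx.
Qed.

Lemma wo_le_lt_trans y x z : R x y -> wo_lt y z -> wo_lt x z.
Proof.
move=> xy /wo_ltNge nzy; apply/wo_ltNge => zx; apply: nzy.
exact: wo_trans zx xy.
Qed.

Lemma wo_lt_trans y x z : wo_lt x y -> wo_lt y z -> wo_lt x z.
Proof. by move=> xy [yz _]; apply: wo_lt_le_trans yz. Qed.

Lemma wo_ltgt x y : [\/ wo_lt x y, x = y | wo_lt y x].
Proof.
have [->|/eqP ne] := eqVneq x y; first by constructor 2.
by case/orP: (wo_total x y) => le; [constructor 1|constructor 3;
  split=> // /esym].
Qed.

Lemma wo_ind (P : T -> Prop) :
  (forall x, (forall y, wo_lt y x -> P y) -> P x) -> forall x, P x.
Proof.
move=> IH; apply: contrapT => /existsNP[x0 Px0].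
have [|x Px minx] := @wo_min [set x | ~ P x]; first by exists x0.
apply: Px; apply: IH => y /wo_ltNge nyx; apply: contrapT => /minx; exact: nyx.
Qed.

(** Transfinite recursion in the form needed for greedy constructions: whether x is chosen depends
    on the set of elements chosen before x. It builds both the minimal transversal and the index set
    of the exposure process. *)
Lemma wo_rec (Phi : T -> set T -> Prop) :
  exists X, forall x, X x <-> Phi x [set y | X y /\ wo_lt y x].
Proof.
have wfR : well_founded wo_lt.
  by move=> x; elim/wo_ind: x => x IH; constructor.
pose body x (rec : forall y, wo_lt y x -> Prop) :=
  Phi x [set y | exists h : wo_lt y x, rec y h].
exists (Fix wfR (fun=> Prop) body) => x.
rewrite Fix_eq => [|y f g eqfg]; last first.
  by rewrite (_ : f = g) //; apply/functional_extensionality_dep => z;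
     apply/functional_extensionality_dep => h; apply: eqfg.
rewrite {1}/body; set X1 := (X in Phi x X); set X2 := (X in _ <-> Phi x X).
rewrite (_ : X1 = X2) //; apply/seteqP; split=> y /=; first by case.
by case=> Xy ltyx; exists ltyx.
Qed.

End WellOrder.

(** * Subspaces and linear maps of a group algebra *)

Lemma lin_comb_split (K : fieldType) (V : lmodType K) (n m : nat) (c : K)
    (a : 'I_n -> K) (b : 'I_m -> K) (x : 'I_n -> V) (y : 'I_m -> V) :
  c *: (\sum_(i < n) a i *: x i) + \sum_(i < m) b i *: y i =
  \sum_(i < n + m)
    (match split i with inl j => c * a j | inr k => b k end) *:
    (match split i with inl j => x j | inr k => y k end).
Proof.
rewrite big_split_ord scaler_sumr /=; congr (_ + _); apply: eq_bigr => i _.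
  by rewrite (unsplitK (inl _ i)) scalerA.
by rewrite (unsplitK (inr _ i)).
Qed.

Section GroupAlgebraSpan.
Variables (K : fieldType) (G : groupType).
Local Notation A := (group_algebra K G).
Implicit Types (f g h : A) (u v w : G) (c : K) (T : set G) (M I : set A).

Definition subspace M : Prop :=
  M 0 /\ forall c f g, M f -> M g -> M (c *: f + g).

Lemma subspaceZ M c f : subspace M -> M f -> M (c *: f).
Proof. by case=> M0 MD Mf; rewrite -[_ *: _]addr0; apply: MD. Qed.

Lemma subspaceD M f g : subspace M -> M f -> M g -> M (f + g).
Proof. by case=> M0 MD Mf Mg; rewrite -[f]scale1r; apply: MD. Qed.

Lemma subspaceB M f g : subspace M -> M f -> M g -> M (f - g).
Proof. by case=> M0 MD Mf Mg; rewrite addrC -scaleN1r; apply: MD. Qed.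

Lemma subspace_sum M (J : eqType) (r : seq J) (F : J -> A) :
  subspace M -> (forall i, i \in r -> M (F i)) -> M (\sum_(i <- r) F i).
Proof.
move=> sM; elim: r => [|i r IHr] MF; first by rewrite big_nil; case: sM.
rewrite big_cons; apply: subspaceD => //; first by apply: MF; rewrite mem_head.
by apply: IHr => j jr; apply: MF; rewrite inE jr orbT.
Qed.

Lemma subspaceI M M' : subspace M -> subspace M' -> subspace (M `&` M').
Proof.
by move=> [M0 MD] [M'0 M'D]; split=> // c f g [? ?] [? ?]; split; auto.
Qed.

Definition right_mul a f : A := f * a.
Definition left_mul a f : A := a * f.

Lemma right_mul_linear a : linear (right_mul a).
Proof. by move=> c f g; rewrite /right_mul mulrDl ga_scaleAl. Qed.
HB.instance Definition _ a :=
  GRing.isLinear.Build K A A _ (right_mul a) (right_mul_linear a).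

Lemma left_mul_linear a : linear (left_mul a).
Proof. by move=> c f g; rewrite /left_mul mulrDr ga_scaleAr. Qed.
HB.instance Definition _ a :=
  GRing.isLinear.Build K A A _ (left_mul a) (left_mul_linear a).

Lemma subspace_preimage (L : {linear A -> A}) M :
  subspace M -> subspace [set f | M (L f)].
Proof.
move=> [M0 MD]; split=> [|c f g Mf Mg] /=; first by rewrite linear0.
by rewrite linearP; apply: MD.
Qed.

Lemma subspace_equalizer (L L' : {linear A -> A}) :
  subspace [set f | L f = L' f].
Proof.
by split=> [|c f g /= Ef Eg] /=; rewrite ?linear0 // !linearP Ef Eg.
Qed.

Lemma subspace_mulr M a : subspace M -> subspace [set f | M (f * a)].
Proof. exact: (subspace_preimage (right_mul a)). Qed.

Lemma ga_scaleEr c f : c *: f = f * c%:A.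
Proof. by rewrite -ga_scaleAr mulr1. Qed.

Lemma right_ideal_subspace I : right_ideal I -> subspace I.
Proof.
by case=> I0 ID IM; split=> // c f g If Ig; rewrite ga_scaleEr; apply/ID/Ig/IM.
Qed.

Lemma right_ideal_gen_ideal (X : set A) : right_ideal (right_ideal_gen X).
Proof.
split=> [J [[]]//|f g Jf Jg J JP|f a Jf J JP].
  by have [[_ JD _] _] := JP; apply: JD; [apply: Jf|apply: Jg].
by have [[_ _ JM] _] := JP; apply: JM; apply: Jf.
Qed.

Lemma sub_right_ideal_gen (X : set A) : X `<=` right_ideal_gen X.
Proof. exact: sub_gen_smallest. Qed.

Lemma right_ideal_gen_sub (X I : set A) :
  right_ideal I -> X `<=` I -> right_ideal_gen X `<=` I.
Proof. exact: smallest_sub. Qed.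

Lemma supported_onP f T : supported_on f T <-> forall u, f@_u != 0 -> T u.
Proof.
by split=> Tf u; [rewrite mcoeff_neq0; apply: Tf
                 |rewrite /supp /= -mcoeff_neq0; apply: Tf].
Qed.

Lemma supported_on_coeff0 f T u : supported_on f T -> ~ T u -> f@_u = 0.
Proof.
by move=> /supported_onP Tf nTu; apply/eqP/negPn/negP => /Tf.
Qed.

Lemma ga_neq0P f : f != 0 -> exists u, f@_u != 0.
Proof.
move=> /eqP f0; apply: contrapT => /forallNP f00; apply: f0.
by apply/malgP => u; rewrite mcoeff0; apply/eqP/negPn/negP/f00.
Qed.

Lemma of_group_coeff u v : (of_group K u)@_v = (u == v)%:R.
Proof. by rewrite mcoeffU. Qed.

Lemma of_groupM u v : of_group K (u * v)%g = of_group K u * of_group K v.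
Proof. by rewrite [RHS]ga_mulUU mulr1. Qed.

Lemma of_groupVK u :
  cancel ( *%R^~ (of_group K u^-1%g)) ( *%R^~ (of_group K u)).
Proof. by move=> f; rewrite -mulrA -of_groupM mulVg mulr1. Qed.

Lemma supported_subspace T : subspace [set f : A | supported_on f T].
Proof.
split=> [|c f g /supported_onP Tf /supported_onP Tg]; apply/supported_onP => u.
  by rewrite mcoeff0 eqxx.
rewrite mcoeffD mcoeffZ; have [fu0|/Tf//] := eqVneq f@_u 0.
by rewrite fu0 mulr0 add0r; apply: Tg.
Qed.

Lemma supported_of_group u T : T u -> supported_on (of_group K u) T.
Proof.
move=> Tu; apply/supported_onP => v; rewrite of_group_coeff.
by have [<-|_] := eqVneq u v; rewrite ?eqxx.
Qed.

Lemma supported_sub f T T' : T `<=` T' -> supported_on f T -> supported_on f T'.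
Proof. by move=> TT' Tf u /Tf/TT'. Qed.

Lemma ga_sumE f : f = \sum_(u <- msupp f) f@_u *: of_group K u.
Proof.
rewrite {1}[f]monalgE; apply: eq_bigr => u _.
by apply/malgP => v; rewrite mcoeffZ !mcoeffU mulrnAr mulr1.
Qed.

Lemma subspace_supported M T f :
  subspace M -> (forall u, T u -> M (of_group K u)) -> supported_on f T -> M f.
Proof.
move=> sM MT Tf; rewrite [f]ga_sumE; apply: subspace_sum => // u uf.
by apply: subspaceZ => //; apply/MT/Tf.
Qed.

Lemma lin_span_subspace (X : set A) : subspace (lin_span X).
Proof.
split=> [|c f g [n [a [x [Xx ->]]]] [m [b [y [Xy ->]]]]].
  by exists 0, (fun=> 0), (fun=> 0); split=> [[]//|]; rewrite big_ord0.
exists (n + m)%N.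
exists (fun i => match split i with inl j => c * a j | inr k => b k end).
exists (fun i => match split i with inl j => x j | inr k => y k end); split.
  by move=> i; case: (split i).
exact: lin_comb_split.
Qed.

Lemma sub_lin_span (X : set A) : X `<=` lin_span X.
Proof.
by move=> f Xf; exists 1, (fun=> 1), (fun=> f); rewrite big_ord1 scale1r.
Qed.

Lemma lin_span_sub (X M : set A) : subspace M -> X `<=` M -> lin_span X `<=` M.
Proof.
move=> sM XM f [n [c [x [Xx ->]]]]; apply: subspace_sum => // i _.
by apply: subspaceZ => //; apply: XM.
Qed.

Lemma SpE T : Sp K T = [set f | supported_on f T].
Proof.
apply/seteqP; split=> f.
  apply: lin_span_sub; first exact: supported_subspace.
  by move=> _ [u Tu <-]; apply: supported_of_group.
move=> /= Tf; apply: (subspace_supported _ _ Tf) => [|u Tu].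
  exact: lin_span_subspace.
by apply: sub_lin_span; exists u.
Qed.

Lemma supported_mul f T T' u :
  (forall v, T v -> T' (v * u)%g) -> supported_on f T ->
  supported_on (f * of_group K u) T'.
Proof.
move=> TT'; apply: (@subspace_supported [set g | supported_on (g * _) T']).
  exact: (subspace_mulr (of_group K u) (supported_subspace T')).
by move=> v /TT' T'uv /=; rewrite -of_groupM; apply: supported_of_group.
Qed.

Section LinearExtension.
Variable phi : G -> A.

Definition lin_ext f : A := \sum_(u <- msupp f) f@_u *: phi u.

Lemma lin_extw (d : {fset G}) f :
  (msupp f `<=` d)%fset -> lin_ext f = \sum_(u <- d) f@_u *: phi u.
Proof.
move=> fd; apply: big_fset_incl => // u _ /mcoeff_outdom ->.
by rewrite scale0r.
Qed.

Lemma lin_ext_is_linear : linear lin_ext.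
Proof.
move=> c f g; pose d := (msupp (c *: f + g) `|` (msupp f `|` msupp g))%fset.
have fd : (msupp f `<=` d)%fset by rewrite /d fsubsetU // fsubsetUl orbT.
have gd : (msupp g `<=` d)%fset by rewrite /d fsubsetU // fsubsetUr orbT.
rewrite (lin_extw fd) (lin_extw gd) (@lin_extw d) ?fsubsetUl // scaler_sumr.
rewrite -big_split; apply: eq_bigr => u _ /=.
by rewrite mcoeffD mcoeffZ scalerDl scalerA.
Qed.

HB.instance Definition _ :=
  GRing.isLinear.Build K A A _ lin_ext lin_ext_is_linear.

Lemma lin_extU u : lin_ext (of_group K u) = phi u.
Proof.
rewrite /lin_ext msuppU oner_eq0 big_seq_fset1 of_group_coeff eqxx.
by rewrite scale1r.
Qed.

End LinearExtension.

Lemma eq_linear_supported (L L' : {linear A -> A}) T f :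
  (forall u, T u -> L (of_group K u) = L' (of_group K u)) ->
  supported_on f T -> L f = L' f.
Proof.
by move=> eqL; apply: (@subspace_supported [set f | L f = L' f]) => //;
  apply: subspace_equalizer.
Qed.

End GroupAlgebraSpan.

(** * Prefix-closed sets of words *)

Section FreeGroupWords.
Variable S : finType.
Local Notation F := (free_group S).
Implicit Types (a b : letter S) (t u v w : F) (T : set F).

Definition ltr a : F := @FreeWord S [:: a] isT.

Lemma ltrV a : ((ltr a)^-1)%g = ltr (linv a).
Proof. exact: val_inj. Qed.

Lemma linv_neq a : linv a != a.
Proof. by case: a => x b; rewrite xpair_eqE eqxx /=; case: b. Qed.

Lemma ltr_inj : injective ltr.
Proof. by move=> a b /(congr1 (@word_of S)) []. Qed.

Lemma reduced_rcons2 (s : seq (letter S)) a b :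
  reduced (rcons s b) -> a != linv b -> reduced (rcons (rcons s b) a).
Proof.
by case: s => [|x s] /=; rewrite /reduced /= ?andbT // !rcons_path last_rcons
  => /andP[-> ->] ->.
Qed.

Lemma mul_ltrP u a :
  word_of (u * ltr a)%g = rcons u a \/ word_of u = rcons (u * ltr a)%g (linv a).
Proof.
case: u => u; case/lastP: u => [|s b] ru; first by left.
have wE : word_of (@FreeWord S _ ru * ltr a)%g = wmul s (lmul b [:: a]).
  by rewrite /mul /= -cats1 wmul_cat.
have [eab|nab] := eqVneq a (linv b).
  right; rewrite wE /= eab eqxx linvK wmul_nil //.
  by have := ru; rewrite /reduced -cats1 => /cat_sorted2[].
left; rewrite wE /= (negPf nab).
have rsba := reduced_rcons2 ru nab.
rewrite -[RHS](wmul_nil rsba) -!cats1 -catA wmul_cat /=.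
by rewrite (negPf nab).
Qed.

Lemma last_letterE (w : F) (s : seq (letter S)) a :
  word_of w = rcons s a -> last_letter w = ltr a.
Proof.
move=> wE; apply: val_inj; rewrite /= wE size_rcons /= -cats1.
by rewrite drop_size_cat.
Qed.

Lemma fgP w : w = 1%g \/
  exists t a, w = (t * ltr a)%g /\ word_of w = rcons t a.
Proof.
case: w => w rw; case/lastP: w rw => [|s a] rw; first by left; apply: val_inj.
have rs : reduced s by have := rw; rewrite /reduced -cats1 => /cat_sorted2[].
right; exists (FreeWord s rs), a; split=> //; apply: val_inj => /=.
by rewrite -{1}(wmul_nil rw) -cats1 wmul_cat.
Qed.

Lemma fg_ind (P : F -> Prop) :
  P 1%g ->
  (forall u a, P u -> word_of (u * ltr a)%g = rcons u a -> P (u * ltr a)%g) ->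
  forall u, P u.
Proof.
move=> P1 PM u; have [n] := ubnP (size u); elim: n u => // n IHn u.
have [->//|[t [a [-> tE]]]] := fgP u; rewrite tE size_rcons ltnS => le_t.
by apply: PM => //; apply: IHn.
Qed.

Lemma prefix_rcons_cases (s t : seq (letter S)) a :
  prefix s (rcons t a) -> s = rcons t a \/ prefix s t.
Proof.
case/prefixP=> s'; case/lastP: s' => [|s' b]; first by rewrite cats0; left.
rewrite -rcons_cat => /rcons_inj[-> _]; right; exact: prefix_prefix.
Qed.

Variable T : set F.
Hypothesis pcT : prefix_closed T.

Definition nbrs a : set F :=
  [set w | prefix_neighbors T w /\ last_letter w = ltr a].

Lemma nbrs_disjoint a b w : nbrs a w -> nbrs b w -> a = b.
Proof. by move=> [_ wa] [_ wb]; apply: ltr_inj; rewrite -wa -wb. Qed.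

Lemma neighbor1 : ~ T 1%g -> prefix_neighbors T 1%g.
Proof.
move=> nT1; split=> // u; rewrite prefixs0 => /eqP u1 /eqP[].
by apply: val_inj.
Qed.

Lemma neighborP w : T 1%g -> prefix_neighbors T w ->
  exists t a, [/\ T t, w = (t * ltr a)%g, word_of w = rcons t a & nbrs a w].
Proof.
move=> T1 Bw; have [w1|[t [a [wE ww]]]] := fgP w.
  by case: Bw; rewrite w1.
exists t, a; split=> //; last by split; last exact: last_letterE ww.
case: Bw => _; apply; first by rewrite ww prefix_rcons.
by apply/eqP => /(congr1 (size \o @word_of S)) /=;
  rewrite ww size_rcons => /n_Sn.
Qed.

(** In the Cayley tree a prefix-closed set can only be left by appending a letter, since cancelling
    one leads to a prefix. *)
Lemma step_transversal t a : T t ->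
  [\/ T (t * ltr a)%g |
      nbrs a (t * ltr a)%g /\ word_of (t * ltr a)%g = rcons t a].
Proof.
move=> Tt; case: (mul_ltrP t a) => [wE|tE]; last first.
  by left; apply: pcT Tt; rewrite tE prefix_rcons.
have [Tta|nTta] := pselect (T (t * ltr a)%g); [by left|right; split=> //].
split; last exact: last_letterE wE.
split=> // u; rewrite wE => /prefix_rcons_cases[uE|/pcT Tu _]; last exact: Tu.
by case/eqP; apply: val_inj; rewrite /= uE -wE.
Qed.

Lemma nbrsK w a : nbrs a w -> T 1%g -> T (w * (ltr a)^-1)%g.
Proof.
move=> Baw T1; have [t [b [Tt wE _ Bbw]]] := neighborP T1 Baw.1.
by rewrite wE (nbrs_disjoint Baw Bbw) mulgK.
Qed.

Lemma nbrs_step t a : T t -> (T `|` nbrs a) (t * ltr a)%g.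
Proof. by move=> /(step_transversal a)[Tta|[Bta _]]; [left|right]. Qed.

Lemma notin_prefix_neighbor w : ~ T w ->
  exists2 v, prefix_neighbors T v & prefix v w.
Proof.
elim/fg_ind: w => [nT1|u a IHu wE nTua].
  by exists 1%g; [exact: neighbor1|exact: prefix_refl].
have [Tu|/IHu[v Bv vu]] := pselect (T u); last first.
  by exists v => //; rewrite wE; apply: prefix_trans vu (prefix_rcons _ _).
have [//|[[Bua _] _]] := step_transversal a Tu.
by exists (u * ltr a)%g => //; apply: prefix_refl.
Qed.

End FreeGroupWords.

(** * Head terms *)

Section Heads.
Variables (K : fieldType) (S : finType) (le : rel (free_group S)).
Local Notation F := (free_group S).
Local Notation A := (group_algebra K F).
Hypothesis woLe : well_order le.
Local Notation lt := (wo_lt le).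
Local Notation HT := (HT le).
Implicit Types (f g h r q : A) (u v w : F) (T : set F) (M R Q : set A).

Lemma finite_max (s : seq F) : s != [::] ->
  exists2 w, w \in s & forall u, u \in s -> le u w.
Proof.
elim: s => // a [_ _|b s IHs _].
  by exists a; rewrite ?mem_head // => u; rewrite inE => /eqP->; exact: wo_refl.
have [//|w ws maxw] := IHs.
have [law|lwa] := orP (wo_total woLe a w).
  exists w; first by rewrite inE ws orbT.
  by move=> u; rewrite inE => /orP[/eqP->//|/maxw].
exists a; first by rewrite mem_head.
move=> u; rewrite inE => /orP[/eqP->|/maxw luw]; first exact: wo_refl.
exact: wo_trans luw lwa.
Qed.

Lemma HTP f : f != 0 -> f@_(HT f) != 0 /\ forall u, f@_u != 0 -> le u (HT f).
Proof.
move=> /ga_neq0P[u0 fu0]; rewrite mcoeff_neq0 in fu0.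
have [|w wf maxw] := @finite_max (msupp f).
  by apply: contraTneq fu0 => E;
    rewrite -[_ \in _]/(u0 \in enum_fset (msupp f)) E.
have [] : is_max le (supp f) (HT f).
  apply: (@xgetPex _ _ (is_max le (supp f))); exists w; split=> // u;
    exact: maxw.
rewrite /supp /= -mcoeff_neq0 => fHT maxHT; split=> // u.
by rewrite mcoeff_neq0; apply: maxHT.
Qed.

Lemma HT_eq f w : f@_w != 0 -> (forall u, f@_u != 0 -> le u w) -> HT f = w.
Proof.
move=> fw maxw; have f0 : f != 0.
  by apply: contraNneq fw => ->; rewrite mcoeff0.
by have [fHT maxHT] := HTP f0; apply: (wo_anti woLe);
  [apply: maxw|apply: maxHT].
Qed.

Lemma HT_support f T : f != 0 -> supported_on f T -> T (HT f).
Proof. by move=> /HTP[fw _] /supported_onP; apply. Qed.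

Lemma HTZ (c : K) f : c != 0 -> HT (c *: f) = HT f.
Proof.
move=> c0; have [->|f0] := eqVneq f 0; first by rewrite scaler0.
have [fw maxw] := HTP f0; apply: HT_eq; first by rewrite mcoeffZ mulf_neq0.
by move=> u; rewrite mcoeffZ mulf_eq0 negb_or => /andP[_ /maxw].
Qed.

Lemma HT_of_group_add w h : supported_on h [set u | lt u w] ->
  HT (of_group K w + h) = w /\ (of_group K w + h)@_w = 1.
Proof.
move=> hw; have E : (of_group K w + h)@_w = 1.
  rewrite mcoeffD of_group_coeff eqxx (supported_on_coeff0 hw) ?addr0 //.
  by case.
split=> //; apply: HT_eq; first by rewrite E oner_eq0.
move=> u; rewrite mcoeffD of_group_coeff; have [<- _|_] := eqVneq w u.
  exact: wo_refl.
by rewrite add0r => hu; have [] := (supported_onP h _).1 hw u hu.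
Qed.

Lemma supported_cancel f r T : r != 0 ->
    supported_on f [set u | T u /\ le u (HT r)] ->
  supported_on r T ->
  supported_on (f - (f@_(HT r) / r@_(HT r)) *: r) [set u | T u /\ lt u (HT r)].
Proof.
move=> r0 /supported_onP fT /supported_onP rT; have [rw maxw] := HTP r0.
apply/supported_onP => u; have [->|/eqP neu] := eqVneq u (HT r).
  by rewrite mcoeffB mcoeffZ divfK ?subrr ?eqxx.
rewrite mcoeffB mcoeffZ; have [->|/fT[Tu luw] _] := eqVneq f@_u 0;
  last by split.
rewrite sub0r oppr_eq0 mulf_eq0 negb_or => /andP[_ ru].
by split; [exact: rT|split; first exact: maxw].
Qed.

Definition heads R : set F := [set w | exists2 r, R r & r != 0 /\ HT r = w].

(** Gaussian elimination along the well-order, by induction on a bound of the support: the top term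
    of h is either cancelled by an element of R with that head or set aside. Only terms at most as
    large as those of h are created, which is what the clause on down-closed sets L records; it
    later keeps corrections below a given head. *)
Lemma heads_reduce R h : subspace R ->
  exists r, [/\ R r, supported_on (h - r) (~` heads R) &
    forall L : set F, (forall u v, le u v -> L v -> L u) ->
      supported_on h L -> supported_on r L].
Proof.
move=> sR; have R0 : R 0 by case: sR.
pose P h r := [/\ R r, supported_on (h - r) (~` heads R) &
  forall L : set F, (forall u v, le u v -> L v -> L u) ->
    supported_on h L -> supported_on r L].
have P0 : P 0 0 by split=> //; rewrite subrr;
  case: (supported_subspace K (~` heads R)).
suff IH w h' : supported_on h' [set u | le u w] -> exists r, P h' r.
  have [->|/HTP[_ maxh]] := eqVneq h 0; first by exists 0.
  by apply: (IH (HT h)); apply/supported_onP.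
elim/(wo_ind woLe): w h' {h} => w IHw h hw.
have IH h1 : supported_on h1 [set u | lt u w] -> exists r, P h1 r.
  move=> h1w; have [->|h10] := eqVneq h1 0; first by exists 0.
  have [h1HT maxh1] := HTP h10; apply: (IHw (HT h1)); last exact/supported_onP.
  exact: (supported_onP h1 _).1 h1w _ h1HT.
have le_bound (L : set F) r : h@_w != 0 -> (forall u v, le u v -> L v -> L u) ->
  supported_on h L -> supported_on r [set u | le u w] -> supported_on r L.
  move=> hw0 downL hL; apply: supported_sub => u /= luw; apply: downL luw _.
  exact: (supported_onP h _).1 hL w hw0.
have downw u v : le u v -> le v w -> le u w by exact: wo_trans.
have [hw0|hw0] := eqVneq h@_w 0.
  apply: IH; apply/supported_onP => u hu; split;
    first exact: (supported_onP h _).1 hw u hu.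
  by move=> E; rewrite E hw0 eqxx in hu.
have ltw f : supported_on f [set u | lt u w] -> supported_on f [set u | le u w].
  by apply: supported_sub => u [].
have [[r0 Rr0 [r00 r0w]]|nw] := pselect (heads R w).
  have r0le : supported_on r0 [set u | le u w].
    by apply/supported_onP => u /(HTP r00).2; rewrite r0w.
  set c := h@_w / r0@_w.
  have h1w : supported_on (h - c *: r0) [set u | lt u w].
    have := @supported_cancel h r0 setT r00.
    rewrite r0w -/c => /(_ _ _)/(supported_sub _); apply=> [u [_]//||//].
    by apply: supported_sub hw.
  have [r1 [Rr1 r1off r1le]] := IH _ h1w; exists (c *: r0 + r1); split.
  - by case: sR => _; apply.
  - by rewrite opprD addrA.
  - move=> L downL hL; apply: le_bound => //.
    have [_ sD] := supported_subspace K [set u | le u w]; apply: sD => //.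
    by apply: r1le => //; apply: ltw.
have [|r1 [Rr1 r1off r1le]] := IH (h - h@_w *: of_group K w).
  apply/supported_onP => u; rewrite mcoeffB mcoeffZ of_group_coeff.
  have [<-|/eqP ne] := eqVneq w u; first by rewrite mulr1 subrr eqxx.
  by rewrite mulr0 subr0 => hu; split;
    [exact: (supported_onP h _).1 hw u hu|exact: nesym].
exists r1; split=> //.
- have -> : h - r1 = h@_w *: of_group K w + (h - h@_w *: of_group K w - r1).
    by rewrite addrA [X in _ = X - r1]addrC subrK.
  have [_ sD] := supported_subspace K (~` heads R).
  exact: (sD _ _ _ (supported_of_group nw) r1off).
move=> L downL hL; apply: le_bound => //; apply: r1le => //; apply: ltw.
apply/supported_onP => u; rewrite mcoeffB mcoeffZ of_group_coeff.
have [<-|/eqP ne] := eqVneq w u; first by rewrite mulr1 subrr eqxx.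
by rewrite mulr0 subr0 => hu; split;
  [exact: (supported_onP h _).1 hw u hu|exact: nesym].
Qed.

Lemma lin_span_seq Q r : lin_span Q r -> exists2 s : seq (K * A),
  (forall p, p \in s -> Q p.2) & r = \sum_(p <- s) p.1 *: p.2.
Proof.
move=> [n [c [x [Qx ->]]]]; exists [seq (c i, x i) | i <- enum 'I_n].
  by move=> _ /mapP[i _ ->] /=; apply: Qx.
by rewrite big_map big_enum.
Qed.

(** Elements with distinct heads cannot cancel each other's heads. In a list representing r, all
    occurrences of the element q with the largest head are collected into one coefficient; if it
    vanishes the list gets shorter, otherwise the head of q survives in r. *)
Lemma HT_lin_span Q r : (forall q, Q q -> q != 0) ->
  (forall q1 q2, Q q1 -> Q q2 -> HT q1 = HT q2 -> q1 = q2) ->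
  lin_span Q r -> r != 0 -> exists2 q, Q q & HT r = HT q.
Proof.
move=> Q0 HTinj /lin_span_seq[s]; have [n] := ubnP (size s).
elim: n s r => // n IHn s r /ltnSE le_s_n Qs rE r0.
have [|w /mapP[p ps wE] maxw] := @finite_max [seq HT p.2 | p <- s].
  by apply: contraNneq r0; rewrite rE; case: (s) => // _; rewrite big_nil.
have Qq := Qs p ps; set q := p.2 in wE Qq.
have [qw maxq] := HTP (Q0 q Qq).
pose s' := [seq p <- s | p.2 != q].
have rE' : r = (\sum_(p <- s | p.2 == q) p.1) *: q + \sum_(p <- s') p.1 *: p.2.
  rewrite rE big_filter (bigID (fun p => p.2 == q)) /=; congr (_ + _).
  by rewrite scaler_suml; apply: eq_bigr => i /eqP ->.
have Qs' i : i \in s' -> Q i.2 by rewrite mem_filter => /andP[_ /Qs].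
have lts' : (size s' < n)%N.
  apply: leq_trans le_s_n;
    rewrite size_filter -(count_predC (fun p => p.2 == q)).
  by rewrite -[X in (X < _)%N]add0n ltn_add2r -has_count; apply/hasP;
    exists p => /=.
move: rE'; set c := \sum_(p <- s | _) _; have [->|c0] := eqVneq c 0.
  by rewrite scale0r add0r => rE'; apply: IHn rE' r0.
set r' := (X in _ + X) => rE'; exists q => //.
have r'lt : supported_on r' [set u | lt u (HT q)].
  apply: (subspace_sum (supported_subspace K _)) => i is'.
  apply: (subspaceZ _ (supported_subspace K _)); have Qi := Qs' i is'.
  have [_ maxi] := HTP (Q0 _ Qi); apply/supported_onP => u /maxi leu.
  apply: (wo_le_lt_trans woLe leu); split.
    rewrite -wE; apply/maxw/mapP; exists i => //.
    by move: is'; rewrite mem_filter => /andP[].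
  by move=> /(HTinj _ _ Qi Qq) E; move: is'; rewrite mem_filter E eqxx.
rewrite rE'; apply: HT_eq.
  rewrite mcoeffD mcoeffZ (supported_on_coeff0 r'lt) => [|[]//].
  by rewrite addr0 mulf_neq0.
move=> u; rewrite mcoeffD mcoeffZ; have [->|/maxq//] := eqVneq q@_u 0.
by rewrite mulr0 add0r => /((supported_onP _ _).1 r'lt)[].
Qed.

End Heads.

(** * Minimal Schreier transversals *)

Section Transversals.
Variables (K : fieldType) (S : finType) (le : rel (free_group S)).
Local Notation F := (free_group S).
Local Notation A := (group_algebra K F).
Hypothesis woLe : well_order le.
Hypothesis preLe : forall u v : F, prefix u v -> le u v.
Local Notation lt := (wo_lt le).
Implicit Types (f g h r : A) (a : letter S) (u v w : F).
Implicit Types (T : set F) (M J : set A).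

Lemma subspace_full M : subspace M -> M (of_group K 1%g) ->
  (forall f a, M f -> M (f * of_group K (ltr a))) -> forall f, M f.
Proof.
move=> sM M1 Mltr f.
have Msupp := @subspace_supported _ _ M setT f sM; apply: Msupp => [u _|//].
elim/fg_ind: u => [|u a Mu _]; first exact: M1.
by rewrite of_groupM; apply: Mltr.
Qed.

(** The elements that reduce to T modulo J form a subspace stable under right multiplication by
    letters, because a step out of T lands on a prefix-neighbor, which reduces by hypothesis. It
    contains 1, which is itself a prefix-neighbor if it is not in T. *)
Lemma transversal_span T J : right_ideal J -> prefix_closed T ->
  (forall w, prefix_neighbors T w ->
     exists2 h, supported_on h T & J (of_group K w - h)) ->
  forall f, exists2 h, supported_on h T & J (f - h).
Proof.
move=> JP pcT redB; have sJ := right_ideal_subspace JP.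
have sT := supported_subspace K T.
pose M := [set f | exists2 h, supported_on h T & J (f - h)].
have sM : subspace M.
  split=> [|c f g [h Th Jh] [k Tk Jk]].
    by exists 0; rewrite ?subrr; [case: sT|case: sJ].
  exists (c *: h + k); first by have := sT.2 c h k Th Tk.
  by rewrite opprD addrACA -scalerBr; apply: (sJ.2 c (f - h) (g - k)).
have MT u : T u -> M (of_group K u).
  by move=> Tu; exists (of_group K u);
    [exact: supported_of_group|rewrite subrr; case: sJ].
apply: (subspace_full sM) => [|f a [h Th Jfh]].
  by have [/MT//|/(@neighbor1 _ T)/redB] := pselect (T 1%g).
rewrite -(subrK h f) mulrDl; apply: (subspaceD sM).
  exists 0; [by case: sT|rewrite subr0; have [_ _ JM] := JP; exact: JM].
apply: (@subspace_supported _ _ [set h | M (h * of_group K (ltr a))] T _ _ _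
  Th) => [|u Tu].
  exact: subspace_mulr.
rewrite /= -of_groupM; have [/MT//|[[/redB]//]] := step_transversal pcT a Tu.
Qed.

Lemma min_transversal_unique T J : is_min_transversal le J T ->
  min_transversal le J = T.
Proof.
move=> minT; apply: xget_unique => // T' minT'; apply: contrapT => neT.
have [w [[wTT' minw] Tw]] := minT.2 T' minT'.1 neT.
have [w' [[wT'T minw'] T'w']] := minT'.2 T minT.1 (nesym neT).
have ww' : w = w'.
  by apply: (wo_anti woLe); [apply: minw|apply: minw']; rewrite setYC.
by case: wTT' => [[_]|[]//]; rewrite ww'.
Qed.

(** For minimality, let w be the first word where T and another transversal T' differ. If w were in
    T' only, its proper prefixes, being smaller, would lie in T, so w would be a prefix-neighbor of
    T; then w - h would be a nonzero element of J supported on T', as h involves only words below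
    w. *)
Lemma min_transversalP T J : right_ideal J -> prefix_closed T ->
  (forall f, J f -> supported_on f T -> f = 0) ->
  (forall w, prefix_neighbors T w ->
     exists2 h, supported_on h [set u | T u /\ lt u w] &
       J (of_group K w - h)) ->
  is_min_transversal le J T.
Proof.
move=> JP pcT T0 redB; have sJ := right_ideal_subspace JP; split;
  first split=> //.
- apply/seteqP; split=> [f [Tf Jf]|f ->] /=; last first.
    by split; [rewrite SpE; case: (supported_subspace K T)|case: JP].
  by rewrite SpE in Tf; exact: T0.
- move=> f; have [|h Th Jfh] := transversal_span JP pcT _ f.
    by move=> w /redB[h Th Jh]; exists h => //; apply: supported_sub Th => u [].
  exists h; split; last by rewrite SpE.
  by rewrite /ideal_coset /= -opprB -scaleN1r; apply: subspaceZ.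
move=> T' [pcT' T'0 _] neTT'.
have [|w wTT' minw] := wo_min woLe (X := T `+` T').
  apply: contrapT => /set0P/negP; rewrite negbK => /eqP E.
  apply: neTT'; apply/seteqP; split=> w Tw; apply: contrapT => nTw.
    by have : (T `+` T') w by [right]; rewrite E.
  by have : (T `+` T') w by [left]; rewrite E.
exists w; split=> //.
case: (wTT') => [[]//|[T'w nTw]]; exfalso.
have TT' u : lt u w -> T u <-> T' u.
  move=> /(wo_ltNge woLe) nwu; split=> Tu; apply: contrapT => nTu; apply: nwu;
  apply: minw; [by left|by right].
have Bw : prefix_neighbors T w.
  split=> // u uw /eqP ne_uw; have ltuw : lt u w by split; first exact: preLe.
  by apply/(TT' u ltuw); apply: pcT' uw T'w.
have [h Th Jh] := redB w Bw.
have : (Sp K T' `&` J) (of_group K w - h).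
  split=> //; rewrite SpE; apply: (subspaceB (supported_subspace K T')).
    exact: supported_of_group.
  by apply: supported_sub Th => u [Tu ltuw]; rewrite -TT'.
rewrite T'0 => /(congr1 (mcoeff w)); rewrite mcoeffB of_group_coeff eqxx.
rewrite (supported_on_coeff0 Th) => [|[]//].
by rewrite subr0 mcoeff0 => /eqP; rewrite oner_eq0.
Qed.

(* T is built greedily: a word all of whose proper prefixes are in T is added *)
(* unless it is congruent modulo J to a combination of smaller words of T.    *)
Lemma min_transversal_exists J : right_ideal J -> exists2 T,
  is_min_transversal le J T &
  forall w, prefix_neighbors T w ->
    exists2 h, supported_on h [set u | T u /\ lt u w] & J (of_group K w - h).
Proof.
move=> JP; have [T TE] := wo_rec woLe (fun w X =>
  (forall u, prefix u w -> u != w -> X u) /\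
  ~ exists2 h : A, supported_on h X & J (of_group K w - h)).
have sJ := right_ideal_subspace JP.
have pcT : prefix_closed T.
  move=> u v uv Tv; have [->//|neuv] := eqVneq u v.
  by have [/(_ u uv neuv)[]] := (TE v).1 Tv.
have redB w : prefix_neighbors T w ->
    exists2 h, supported_on h [set u | T u /\ lt u w] & J (of_group K w - h).
  move=> [nTw Tpre]; apply: contrapT => nh; apply: nTw; apply/TE; split=> //.
  move=> u uw neuw; split; first exact: Tpre.
  by split; [exact: preLe|apply/eqP].
exists T => //; apply: min_transversalP => // f Jf Tf;
  apply/eqP/negPn/negP => f0.
have [fw maxw] := HTP woLe f0; set w := HT le f in fw maxw.
have [_] := (TE w).1 ((supported_onP f T).1 Tf w fw); apply.
exists (of_group K w - ((of_group K w)@_w / f@_w) *: f).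
  apply: (supported_cancel woLe f0 _ Tf); apply: supported_of_group.
  by split; [exact: ((supported_onP f T).1 Tf w fw)|exact: wo_refl].
by rewrite subKr; apply: subspaceZ.
Qed.

End Transversals.

(** * Ideals generated by flip-stable subspaces *)

Section IdealFromNeighbors.
Variables (K : fieldType) (S : finType) (le : rel (free_group S)).
Local Notation F := (free_group S).
Local Notation A := (group_algebra K F).
Local Notation lt := (wo_lt le).
Local Notation HT := (HT le).
Local Notation heads := (heads le).
Hypothesis woLe : well_order le.
Hypothesis preLe : forall u v : F, prefix u v -> le u v.
Variables (I : set A) (T : set F).
Hypothesis idealI : right_ideal I.
Hypothesis pcT : prefix_closed T.
Hypothesis T1 : T 1%g.
Hypothesis IT0 : forall f, I f -> supported_on f T -> f = 0.
Hypothesis redT : forall w, prefix_neighbors T w ->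
  exists2 h : A, supported_on h [set u | T u /\ lt u w] & I (of_group K w - h).
Implicit Types (f g h r q : A) (a b : letter S) (u v w d : F) (J : set A).

Let sI : subspace I := right_ideal_subspace idealI.

(** The space V_a of the overview. *)
Definition edge_space a : set A :=
  [set f | I f /\ supported_on f (T `|` nbrs T a)].

Lemma edge_space_subspace a : subspace (edge_space a).
Proof. exact: subspaceI sI (supported_subspace K _). Qed.

(** Multiplying by the inverse of a strips the last letter from the neighbors ending in a, and moves
    words of T along an edge labelled by that inverse. *)
Lemma edge_space_flip a f : edge_space a f ->
  edge_space (linv a) (f * of_group K (ltr (linv a))).
Proof.
have [_ _ IM] := idealI; move=> [If Tf]; split; first exact: IM.
apply: supported_mul Tf => u [Tu|Bu]; first exact: nbrs_step.
by left; rewrite -ltrV; apply: nbrsK Bu T1.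
Qed.

(** If the head t were in T, replacing each neighbor in the support by its reduction to smaller
    words of T would leave the coefficient of t intact and produce a nonzero element of I supported
    on T. *)
Lemma edge_space_HT a f : edge_space a f -> f != 0 -> nbrs T a (HT f).
Proof.
move=> [If Tf] f0; case: (HT_support woLe f0 Tf) => // Tt; exfalso.
have [ft maxt] := HTP woLe f0; set t := HT f in ft maxt Tt.
pose M := [set h | exists2 h',
  supported_on h' [set u | T u /\ lt u t] & I (h - h')].
have sTt := supported_subspace K [set u | T u /\ lt u t].
have sM : subspace M.
  split=> [|c h k [h' Th' Ih] [k' Tk' Ik]].
    by exists 0; rewrite ?subrr; [case: sTt|case: sI].
  exists (c *: h' + k'); first by have := sTt.2 c h' k' Th' Tk'.
  by rewrite opprD addrACA -scalerBr; apply: (sI.2 c (h - h') (k - k')).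
have ltf : supported_on (f - f@_t *: of_group K t)
    [set u | (T `|` nbrs T a) u /\ lt u t].
  apply/supported_onP => u; rewrite mcoeffB mcoeffZ of_group_coeff.
  have [<-|/eqP ne] := eqVneq t u; first by rewrite mulr1 subrr eqxx.
  rewrite mulr0 subr0 => fu; split;
    first exact: ((supported_onP f _).1 Tf u fu).
  by split; [exact: maxt|exact: nesym].
have [|h' Th' Ih'] := @subspace_supported _ _ M _ _ sM _ ltf.
  move=> u [[Tu|[Bu _]] ltut].
    exists (of_group K u); first exact: supported_of_group.
    by rewrite subrr; case: sI.
  have [h Th Ih] := redT Bu; exists h => //.
  by apply: supported_sub Th => v [Tv ltvu]; split=> //;
    apply: wo_lt_trans ltvu ltut.
have: I (f@_t *: of_group K t + h').
  have := subspaceB sI If Ih'; rewrite !opprB addrC -addrA subrK.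
  by rewrite addrC.
move/IT0 => E; have : supported_on (f@_t *: of_group K t + h') T.
  apply: (subspaceD (supported_subspace K T)).
    by apply: (subspaceZ _ (supported_subspace K T)); apply: supported_of_group.
  by apply: supported_sub Th' => u [].
move=> /E/(congr1 (mcoeff t));
  rewrite mcoeffD mcoeffZ of_group_coeff eqxx mulr1.
rewrite (supported_on_coeff0 Th') => [|[_ []]//].
by rewrite addr0 mcoeff0; apply/eqP.
Qed.

Section FlipClosedFamily.
Variable R : letter S -> set A.
Hypothesis sR : forall a, subspace (R a).
Hypothesis R_edge : forall a, R a `<=` edge_space a.
Hypothesis R_flip : forall a f, R a f ->
  R (linv a) (f * of_group K (ltr (linv a))).

Definition head_edges : set F := [set d | exists a, heads (R a) d].
Definition reduced_words : set F :=
  [set w | forall d, head_edges d -> ~~ prefix d w].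

Local Notation D := head_edges.
Local Notation TD := reduced_words.

Lemma heads_nbrs a : heads (R a) `<=` nbrs T a.
Proof. by move=> d [r /R_edge Vr [r0 <-]]; apply: edge_space_HT. Qed.

Lemma head_edges_notin d : D d -> ~ TD d.
Proof. by move=> Dd /(_ d Dd); rewrite prefix_refl. Qed.

Lemma reduced_words_pc : prefix_closed TD.
Proof.
by move=> u v uv TDv d /TDv; apply: contraNN => du; apply: prefix_trans du uv.
Qed.

Lemma sub_reduced_words : T `<=` TD.
Proof.
move=> w Tw d [a /heads_nbrs[[nTd _] _]]; apply/negP => dw.
by apply: nTd; apply: pcT dw Tw.
Qed.

Lemma nbrs_reduced a w : nbrs T a w -> ~ heads (R a) w -> TD w.
Proof.
move=> aw nw d [b bd]; apply/negP => dw; have [dwE|ne] := eqVneq d w.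
  have bw := heads_nbrs bd; rewrite dwE in bd bw.
  by apply: nw; rewrite (nbrs_disjoint aw bw).
by have [[nTd _] _] := heads_nbrs bd; apply: nTd; apply: aw.1.2.
Qed.

Lemma reduced_words_nbrs w : prefix_neighbors TD w -> D w.
Proof.
move=> [nTDw TDpre]; apply: contrapT => nDw; apply: nTDw => d Dd.
apply/negP => dw; have [dwE|ne] := eqVneq d w; first by rewrite dwE in Dd.
by apply: (head_edges_notin Dd); apply: TDpre.
Qed.

(** This is the reduced element of R_a with head d: scale an element with that head to leading
    coefficient 1, then clear the remaining heads of R_a from its lower terms. *)
Lemma reducer_exists a d : heads (R a) d -> exists2 q, R a q &
  supported_on (of_group K d - q) [set u | TD u /\ lt u d].
Proof.
move=> ad; case: (ad) => r Rr [r0 rd].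
have [Ir Tr] := R_edge Rr; have [rw maxr] := HTP woLe r0; rewrite rd in rw maxr.
pose h := (r@_d)^-1 *: r - of_group K d.
have hd : supported_on h [set u | (T `|` nbrs T a) u /\ lt u d].
  apply/supported_onP => u; rewrite mcoeffB mcoeffZ of_group_coeff.
  have [<-|/eqP ne] := eqVneq d u; first by rewrite mulVf // subrr eqxx.
  rewrite subr0 mulf_eq0 negb_or => /andP[_ ru].
  by split; [exact: ((supported_onP r _).1 Tr)|split;
    [exact: maxr|exact: nesym]].
have [q [Rq qoff qle]] := heads_reduce woLe h (sR a).
have qd : supported_on q [set u | lt u d].
  apply: qle; last by apply: supported_sub hd => u [].
  by move=> u v uv vd; apply: wo_le_lt_trans uv vd.
have [_ Tq] := R_edge Rq.
exists ((r@_d)^-1 *: r - q); first exact: subspaceB (subspaceZ _ (sR a) Rr) Rq.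
have -> : of_group K d - ((r@_d)^-1 *: r - q) = - (h - q).
  by rewrite /h !opprB addrCA addrA.
have hq_lt : supported_on (h - q) [set u | (T `|` nbrs T a) u].
  apply: (subspaceB (supported_subspace K _)) Tq.
  by apply: supported_sub hd => u [].
have hq_lt2 : supported_on (h - q) [set u | lt u d].
  apply: (subspaceB (supported_subspace K [set u | lt u d])) qd.
  by apply: supported_sub hd => u [].
apply/supported_onP => u; rewrite mcoeffN oppr_eq0 => hqu; split.
  case: ((supported_onP _ _).1 hq_lt u hqu) => [/sub_reduced_words//|au].
  by apply: nbrs_reduced au _; apply: (supported_onP _ _).1 qoff u hqu.
exact: (supported_onP _ _).1 hq_lt2 u hqu.
Qed.

(** The value 0 on reduced words makes [normal_form] fix them. Quantifying over all letters a is
    consistent because a neighbor determines its last letter. *)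
Lemma reducer_fun_exists : exists qhat : F -> A, forall d,
  (TD d -> qhat d = 0) /\ forall a, heads (R a) d ->
  R a (qhat d) /\ supported_on (of_group K d - qhat d) [set u | TD u /\ lt u d].
Proof.
have [|q qP] := @choice F A (fun d q => (TD d -> q = 0) /\
  forall a, heads (R a) d ->
  R a q /\ supported_on (of_group K d - q) [set u | TD u /\ lt u d]);
    last by exists q.
move=> d; have [[a ad]|nDd] := pselect (D d); last first.
  by exists 0; split=> // a ad; case: nDd; exists a.
have [q Rq dq] := reducer_exists ad; exists q; split=> [TDd|b bd].
  by case: (head_edges_notin _ TDd); exists a.
by rewrite (nbrs_disjoint (heads_nbrs bd) (heads_nbrs ad)).
Qed.

(** * Rewriting of heads and the resulting action of F *)

Section NormalForm.
Variable qhat : F -> A.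
Hypothesis qhatP : forall d, (TD d -> qhat d = 0) /\ forall a, heads (R a) d ->
  R a (qhat d) /\ supported_on (of_group K d - qhat d) [set u | TD u /\ lt u d].

Definition normal_form : A -> A := lin_ext (fun u => of_group K u - qhat u).
HB.instance Definition _ := GRing.Linear.on normal_form.
Local Notation NF := normal_form.

Lemma normal_formU u : NF (of_group K u) = of_group K u - qhat u.
Proof. exact: lin_extU. Qed.

Lemma normal_form_id f : supported_on f TD -> NF f = f.
Proof.
apply: (@eq_linear_supported _ _ NF idfun) => u TDu /=.
by rewrite normal_formU (qhatP u).1 // subr0.
Qed.

Lemma normal_form_supp f : supported_on f (TD `|` D) -> supported_on (NF f) TD.
Proof.
have sM := subspace_preimage NF (supported_subspace K TD).
apply: (subspace_supported sM) => u /=.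
have [q0 qd] := qhatP u; rewrite normal_formU => -[TDu|[a /qd[_]]].
  by rewrite q0 // subr0; apply: supported_of_group.
by apply: supported_sub => v [].
Qed.

(** Rewriting changes r by elements of R_a only, so the result is in R_a; being supported on reduced
    words it has no room for a head in D, hence vanishes. *)
Lemma normal_form_R a r : R a r -> NF r = 0.
Proof.
move=> Rr; have [_ Tr] := R_edge Rr; have [R0 RD] := sR a.
pose M := [set f | R a (NF f - f)].
have sM : subspace M := subspace_preimage (NF \- idfun) (sR a).
have RNFr : R a (NF r).
  rewrite -[NF r](subrK r) -[X in X + r]scale1r; apply: RD => //.
  apply: (subspace_supported sM _ Tr) => u Tau.
  have [q0 qd] := qhatP u;
    rewrite /M /= normal_formU [X in R a X]addrAC subrr add0r.
  have [TDu|nTDu] := pselect (TD u); first by rewrite q0 ?oppr0.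
  case: Tau => [/sub_reduced_words//|au].
  have [|Rq _] := qd a; first by apply: contrapT => /(nbrs_reduced au).
  by rewrite -sub0r; apply: subspaceB.
have : supported_on (NF r) TD.
  apply: normal_form_supp; apply: supported_sub Tr => u [Tu|au].
    by left; apply: sub_reduced_words.
  have [ad|/(nbrs_reduced au)] := pselect (heads (R a) u); last by left.
  by right; exists a.
move=> TNFr; apply/eqP/negPn/negP => NFr0.
have := HT_support woLe NFr0 TNFr; apply: head_edges_notin.
by exists a, (NF r).
Qed.

Lemma supported_ltr h a : supported_on h TD ->
  supported_on (h * of_group K (ltr a)) (TD `|` D).
Proof.
apply: supported_mul => u TDu.
have [|[[/reduced_words_nbrs ? _] _]] :=
  step_transversal reduced_words_pc a TDu.
  by left.
by right.
Qed.

(** It suffices to treat a word t. If t a is reduced nothing is rewritten. Otherwise t a is a head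
    in D and is replaced by t a - q with q in R_a; the flip of q lies in R_(a^-1) and is killed by
    the second normal form, which leaves t. *)
Lemma normal_formK h a : supported_on h TD ->
  NF (NF (h * of_group K (ltr a)) * of_group K (ltr (linv a))) = h.
Proof.
move=> Th; apply: (@eq_linear_supported _ _
  ((NF \o right_mul (of_group K (ltr (linv a)))) \o
   (NF \o right_mul (of_group K (ltr a)))) idfun TD h _ Th).
move=> t Tt; rewrite /= /right_mul -of_groupM -ltrV.
have [TDta|[[/reduced_words_nbrs Dta tal] taE]] :=
  step_transversal reduced_words_pc a Tt.
  rewrite (normal_form_id (supported_of_group TDta)) -of_groupM mulgK.
  exact: normal_form_id (supported_of_group Tt).
have [b bd] := Dta; have [_ /(_ b bd)[Rq _]] := qhatP (t * ltr a)%g.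
have ab : b = a by apply: ltr_inj; rewrite -tal; have [_ <-] := heads_nbrs bd.
rewrite ab in Rq; have := R_flip Rq; rewrite -ltrV => /normal_form_R Rq0.
rewrite normal_formU mulrBl (linearB NF) [X in _ - X]Rq0 subr0 -of_groupM mulgK.
exact: normal_form_id (supported_of_group Tt).
Qed.

(* A word of TD acts on 1 as itself and each generator of the ideal kills 1.   *)
(* Flip-stability of R is what makes a letter and its inverse act inversely   *)
(* (normal_formK), so that this is an action of the group.                    *)
Definition word_action (s : seq (letter S)) : A :=
  foldl (fun h a => NF (h * of_group K (ltr a))) (of_group K 1%g) s.

Lemma word_action_supp s : supported_on (word_action s) TD.
Proof.
rewrite /word_action; have : supported_on (of_group K (1%g : F)) TD.
  exact: supported_of_group (sub_reduced_words T1).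
elim: s (of_group K 1%g) => //= a s IHs h Th; apply: IHs.
exact/normal_form_supp/supported_ltr.
Qed.

Lemma word_action_mul (u : F) a :
  word_action (u * ltr a)%g = NF (word_action u * of_group K (ltr a)).
Proof.
case: (mul_ltrP u a) => [->|uE]; first by rewrite /word_action foldl_rcons.
rewrite [in RHS]uE /word_action foldl_rcons -/(word_action _).
rewrite -[X in _ = NF (_ * of_group K (ltr X))]linvK normal_formK //.
exact: word_action_supp.
Qed.

Lemma word_action_id u : TD u -> word_action u = of_group K u.
Proof.
elim/fg_ind: u => // u a IHu wE TDua; rewrite word_action_mul IHu.
  by rewrite -of_groupM normal_form_id //; apply: supported_of_group.
by apply: reduced_words_pc TDua; rewrite wE prefix_rcons.
Qed.

Definition action : A -> A := lin_ext (fun u => word_action u).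
HB.instance Definition _ := GRing.Linear.on action.

Lemma actionU u : action (of_group K u) = word_action u.
Proof. exact: lin_extU. Qed.

Lemma action_ltr f a :
  action (f * of_group K (ltr a)) = NF (action f * of_group K (ltr a)).
Proof.
have fT : supported_on f setT by move=> ? _.
apply: (@eq_linear_supported _ _ (action \o right_mul (of_group K (ltr a)))
  (NF \o right_mul (of_group K (ltr a)) \o action) setT f _ fT) => u _.
change (action (of_group K u * of_group K (ltr a)) =
        NF (action (of_group K u) * of_group K (ltr a))).
by rewrite -of_groupM actionU word_action_mul (actionU u).
Qed.

Lemma action_id f : supported_on f TD -> action f = f.
Proof.
apply: (@eq_linear_supported _ _ action idfun) => u TDu /=.
by rewrite actionU word_action_id.
Qed.

Lemma action_normal_form f : supported_on f (TD `|` D) -> action f = NF f.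
Proof.
apply: (@eq_linear_supported _ _ action NF) => u TDDu /=.
rewrite actionU; case: TDDu => [TDu|[a /heads_nbrs[Bd _]]].
  by rewrite word_action_id // normal_form_id //; apply: supported_of_group.
have [t [b [Tt -> _ _]]] := neighborP T1 Bd.
by rewrite word_action_mul word_action_id ?of_groupM //;
  apply: sub_reduced_words.
Qed.

Lemma action_ker_ideal : right_ideal [set f | action f = 0].
Proof.
split=> [|f g /= Ef Eg|f x /= Ef]; first exact: linear0.
  by rewrite (linearD action) [X in X + _]Ef [X in _ + X]Eg addr0.
have sM := subspace_equalizer (action \o left_mul f) \0.
apply: (subspace_full sM) => [|g a] /=; rewrite /left_mul.
  by rewrite mulr1.
by move=> Mg; rewrite mulrA action_ltr Mg mul0r linear0.
Qed.

End NormalForm.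

Definition generated_ideal : set A := right_ideal_gen (\bigcup_a R a).

(** On R_a the action is the normal form, which kills it, so the ideal lies in the kernel of
    [action]; but [action] fixes everything supported on reduced words. *)
Lemma generated_ideal_reduced f : generated_ideal f -> supported_on f TD ->
    f = 0.
Proof.
have [qhat qhatP] := reducer_fun_exists.
move=> Jf Tf; rewrite -(action_id qhatP Tf).
move: Jf; apply: (right_ideal_gen_sub (action_ker_ideal qhatP)).
move=> r [a _ Rr] /=; rewrite (action_normal_form qhatP).
  exact: (normal_form_R qhatP Rr).
have [_ Tr] := R_edge Rr; apply: supported_sub Tr => u [Tu|au].
  by left; apply: sub_reduced_words.
have [ad|/(nbrs_reduced au)] := pselect (heads (R a) u); last by left.
by right; exists a.
Qed.

Lemma generated_ideal_transversal : min_transversal le generated_ideal = TD.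
Proof.
have [qhat qhatP] := reducer_fun_exists.
apply: (min_transversal_unique woLe); apply: min_transversalP => //.
- exact: right_ideal_gen_ideal.
- exact: reduced_words_pc.
- exact: generated_ideal_reduced.
move=> w /reduced_words_nbrs[a aw]; have [_ /(_ a aw)[Rq qw]] := qhatP w.
exists (of_group K w - qhat w) => //; rewrite subKr.
by apply: sub_right_ideal_gen; exists a.
Qed.

(** Subtracting an element of R_a clears the heads of R_a from f; what remains is in the ideal and
    supported on reduced words, so it is zero. *)
Lemma generated_ideal_edge_space a f :
  generated_ideal f -> edge_space a f -> R a f.
Proof.
move=> Jf Vf; have [r [Rr foff _]] := heads_reduce woLe f (sR a).
suff: f - r = 0 by move/eqP; rewrite subr_eq0 => /eqP ->.
apply: generated_ideal_reduced.
  apply: (subspaceB (right_ideal_subspace (right_ideal_gen_ideal _))) => //.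
  by apply: sub_right_ideal_gen; exists a.
have [_ Tfr] := subspaceB (edge_space_subspace a) Vf (R_edge Rr).
apply/supported_onP => u fru; case: ((supported_onP _ _).1 Tfr u fru).
  exact: sub_reduced_words.
by move=> /nbrs_reduced; apply; apply: (supported_onP _ _).1 foff u fru.
Qed.

End FlipClosedFamily.

(** * Stages of the exposure process *)

Definition trace J a : set A := J `&` edge_space a.

(** The invariant of the stages. It makes J the ideal generated by the flip-stable family of its own
    traces, so that the preceding results apply to J. *)
Definition edge_generated J : Prop :=
  [/\ right_ideal J, J `<=` I & J `<=` right_ideal_gen (\bigcup_a trace J a)].

Lemma right_ideal_gen_edge_generated (X : set A) :
  X `<=` \bigcup_a edge_space a -> edge_generated (right_ideal_gen X).
Proof.
move=> XV; have genI := right_ideal_gen_ideal X; split=> //.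
  by apply: right_ideal_gen_sub => // f /XV[a _ []].
apply: right_ideal_gen_sub; first exact: right_ideal_gen_ideal.
move=> f Xf; have [a _ Vf] := XV f Xf; apply: sub_right_ideal_gen.
by exists a => //; split=> //; apply: sub_right_ideal_gen.
Qed.

Local Notation words J := (reduced_words (trace J)).

Section Stage.
Variable J : set A.
Hypothesis goodJ : edge_generated J.

Let idealJ : right_ideal J. Proof. by case: goodJ. Qed.
Let JI : J `<=` I. Proof. by case: goodJ. Qed.

Lemma trace_subspace a : subspace (trace J a).
Proof.
exact: subspaceI (right_ideal_subspace idealJ) (edge_space_subspace a).
Qed.

Lemma trace_edge a : trace J a `<=` edge_space a. Proof. by move=> f []. Qed.

Lemma trace_flip a f : trace J a f ->
  trace J (linv a) (f * of_group K (ltr (linv a))).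
Proof.
have [_ _ JM] := idealJ.
by move=> [Jf Vf]; split; [exact: JM|exact: edge_space_flip].
Qed.

Lemma generated_ideal_trace : generated_ideal (trace J) = J.
Proof.
have [_ _ Jgen] := goodJ; apply/seteqP; split=> //.
by apply: right_ideal_gen_sub => // f [a _ []].
Qed.

Lemma stage_transversal : min_transversal le J = words J.
Proof.
rewrite -{1}generated_ideal_trace.
exact: generated_ideal_transversal trace_subspace trace_edge trace_flip.
Qed.

Lemma stage_words0 f : J f -> supported_on f (words J) -> f = 0.
Proof.
rewrite -{1}generated_ideal_trace.
exact: generated_ideal_reduced trace_subspace trace_edge trace_flip _.
Qed.

Lemma sub_stage_words : T `<=` words J.
Proof. exact: sub_reduced_words trace_edge. Qed.

Lemma trace_HT_notin a f : trace J a f -> f != 0 -> ~ words J (HT f).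
Proof.
by move=> Jf f0; apply: head_edges_notin; exists a, f.
Qed.

Lemma stage_reduce a f : edge_space a f -> exists2 r, trace J a r &
  supported_on (f - r) (words J).
Proof.
move=> Vf; have [r [Rr foff _]] := heads_reduce woLe f (trace_subspace a).
exists r => //; have [_ Tfr] :=
  subspaceB (edge_space_subspace a) Vf (trace_edge Rr).
apply/supported_onP => u fru; case: ((supported_onP _ _).1 Tfr u fru).
  exact: sub_stage_words.
by move=> /(nbrs_reduced trace_edge); apply;
  apply: (supported_onP _ _).1 foff u fru.
Qed.

End Stage.

Lemma stage_words_mono J J' : J `<=` J' -> words J' `<=` words J.
Proof.
move=> JJ' w J'w d [a [r [Jr Vr] r0]]; apply: J'w; exists a, r => //.
by split=> //; apply: JJ'.
Qed.

(** * The next exposed element and its second *)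

Variable g : F -> A.
Hypothesis gP : forall w, prefix_neighbors T w ->
  I (g w) /\ supported_on (g w - of_group K w) [set u | T u /\ lt u w].

Lemma g_edge w a : nbrs T a w -> edge_space a (g w).
Proof.
move=> aw; have [Igw gw] := gP aw.1; split=> //.
rewrite -[g w](subrK (of_group K w)).
apply: (subspaceD (supported_subspace K _)).
  by apply: supported_sub gw => u [Tu _]; left.
by apply: supported_of_group; right.
Qed.

Lemma g_HT w : prefix_neighbors T w -> HT (g w) = w /\ (g w)@_w = 1.
Proof.
move=> /gP[_ gw]; rewrite -[g w](subrK (of_group K w)) addrC.
by apply: (HT_of_group_add woLe); apply: supported_sub gw => u [].
Qed.

Lemma g_neq0 w : prefix_neighbors T w -> g w != 0.
Proof.
move=> /g_HT[_]; apply: contra_eqN => /eqP ->.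
by rewrite mcoeff0 eq_sym oner_eq0.
Qed.

Lemma g_edge_exists w : prefix_neighbors T w -> exists2 a, nbrs T a w &
  edge_space a (g w).
Proof.
move=> Bw; have [_ [a [_ _ _ aw]]] := neighborP T1 Bw.
by exists a => //; apply: g_edge.
Qed.

(** With the [g w] available, an element of I reduces modulo J and I at once to something supported
    on T, where I is zero. *)
Lemma g_generates J : right_ideal J ->
  (forall w, prefix_neighbors T w -> J (g w)) -> I `<=` J.
Proof.
move=> idealJ Jg f If; have sJ := right_ideal_subspace idealJ.
have idealJI : right_ideal (J `&` I).
  have [J0 JD JM] := idealJ; have [I0 ID IM] := idealI.
  by split=> // [h k [? ?] [? ?]|h x [? ?]]; split; auto.
have [|h Th [Jfh Ifh]] := transversal_span idealJI pcT _ f.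
  move=> w Bw; have [Igw gw] := gP Bw; exists (of_group K w - g w).
    rewrite -opprB -sub0r; apply: (subspaceB (supported_subspace K T)).
      by case: (supported_subspace K T).
    by apply: supported_sub gw => u [].
  by rewrite subKr; split=> //; apply: Jg.
have h0 : h = 0 by apply: IT0 Th; rewrite -[h](subKr f); apply: subspaceB.
by rewrite h0 subr0 in Jfh.
Qed.

Definition next J w : Prop := is_min le (prefix_neighbors T `&` words J) w.

(** If no prefix-neighbor of T survived in the transversal of J, each [g w] would reduce modulo J to
    an element of I supported on T, that is to 0; then J would contain all [g w] and equal I. *)
Lemma next_exists J : edge_generated J -> J <> I -> exists w, next J w.
Proof.
move=> goodJ JneI; have [idealJ JI _] := goodJ.
have [//|w [Bw TJw] minw] := wo_min woLe (X := prefix_neighbors T `&` words J).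
  apply: contrapT => /set0P/negP; rewrite negbK => /eqP E; apply: JneI.
  apply/seteqP; split=> //; apply: g_generates => // w Bw.
  have [a aw Vg] := g_edge_exists Bw.
  have [r [Jr Vr] gr] := stage_reduce goodJ Vg.
  suff: g w - r = 0 by move/eqP; rewrite subr_eq0 => /eqP ->.
  have [Igr Tgr] := subspaceB (edge_space_subspace a) Vg Vr.
  apply: IT0 => //; apply/supported_onP => u gru.
  case: ((supported_onP _ _).1 Tgr u gru) => // -[Bu _].
  have : (prefix_neighbors T `&` words J) u.
    by split=> //; apply: (supported_onP _ _).1 gr u gru.
  by rewrite E.
by exists w.
Qed.

(** A word of the transversal of J outside T has a prefix that is a surviving neighbor, hence is at
    least w. *)
Lemma lt_next J w u : next J w -> words J u -> lt u w -> T u.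
Proof.
move=> [_ minw] TJu ltuw;
  apply: contrapT => /(notin_prefix_neighbor pcT)[v Bv vu].
have lewv : le w v by apply: minw; split=> //; apply: reduced_words_pc vu TJu.
by have /(wo_ltNge woLe) := ltuw; apply; apply: wo_trans lewv (preLe vu).
Qed.

Lemma next_candidate J w : edge_generated J -> next J w ->
  exposed_candidate le I J (g w).
Proof.
move=> goodJ [[Bw TJw] _]; have [Igw gw] := gP Bw; have [HTw gww] := g_HT Bw.
split=> //; first by split; [exact: g_neq0|rewrite /HC HTw].
rewrite (stage_transversal goodJ) -[g w](subrK (of_group K w)).
apply: (subspaceD (supported_subspace K _)); last exact: supported_of_group.
by apply: supported_sub gw => u [Tu _]; apply: sub_stage_words.
Qed.

(** Below w the transversal of J agrees with T. A head smaller than w would thus put f in I and on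
    T, forcing f to be 0; if the head is w, the same argument applies to the difference with [g w],
    where w cancels. *)
Lemma candidate_le_next J w f : edge_generated J -> next J w ->
  exposed_candidate le I J f -> le (HT f) w -> f = g w.
Proof.
move=> goodJ nw [If [f0 fHC]]; rewrite (stage_transversal goodJ) => TJf lefw.
have [[Bw TJw] _] := nw; have [Igw gw] := gP Bw; have [HTw gww] := g_HT Bw.
have [fHT maxf] := HTP woLe f0.
have [fw|/eqP new] := eqVneq (HT f) w; last first.
  suff /IT0 E : supported_on f T by rewrite E // eqxx in f0.
  apply/supported_onP => u fu; apply: (lt_next nw).
    exact: (supported_onP _ _).1 TJf u fu.
  by apply: (wo_le_lt_trans woLe (maxf u fu)).
apply/eqP; rewrite -subr_eq0; apply/eqP/IT0; first exact: subspaceB.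
apply/supported_onP => u; rewrite mcoeffB.
have [->|/eqP neu] := eqVneq u w.
  by rewrite gww -[X in _@_X]fw; move: fHC; rewrite /HC => ->;
    rewrite subrr eqxx.
have [fu0|fu] := eqVneq f@_u 0.
  rewrite fu0 sub0r oppr_eq0 => gu.
  have [] // := (supported_onP _ _).1 gw u _.
  rewrite mcoeffB of_group_coeff; move/eqP/negPf: neu; rewrite eq_sym => ->.
  by rewrite subr0.
move=> _; apply: (lt_next nw); first exact: (supported_onP _ _).1 TJf u fu.
by split=> //; rewrite -fw; apply: maxf.
Qed.

(** Any other candidate has a head beyond w, and this head is the maximum of the symmetric
    difference with the support of [g w]. So [g w] is the smallest candidate for [lt_max]. *)
Lemma exposedE J w f : edge_generated J -> next J w ->
  is_exposed le I J f <-> f = g w.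
Proof.
move=> goodJ nw; have gcand := next_candidate goodJ nw.
have [[Bw _] _] := nw; have [HTw gww] := g_HT Bw.
have gsupp u : supp (g w) u -> le u w.
  rewrite /supp /= -mcoeff_neq0 -[X in le _ X]HTw.
  exact: (HTP woLe (g_neq0 Bw)).2.
have gt_max h : exposed_candidate le I J h -> h <> g w ->
    is_max le (supp (g w) `+` supp h) (HT h) /\ supp h (HT h).
  move=> hcand neh; have [_ [h0 _] _] := hcand.
  have [hHT maxh] := HTP woLe h0; have nle : ~ le (HT h) w.
    by move=> /(candidate_le_next goodJ nw hcand).
  have hsupp : supp h (HT h) by rewrite /supp /= -mcoeff_neq0.
  split=> //; split; first by right; split=> // /gsupp.
  move=> u [[/gsupp leuw _]|[hu _]]; last first.
    by apply: maxh; rewrite mcoeff_neq0.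
  by have [lt _] := (wo_ltNge woLe w (HT h)).2 nle; apply: wo_trans leuw lt.
split=> [[fcand minf]|->].
  apply: contrapT => nef; apply: (minf _ gcand); exists (HT f).
  exact: gt_max.
split=> // h hcand [m [[gm maxm] gwm]].
have [hE|neh] := eqVneq h (g w).
  by move: gm; rewrite hE => -[[]|[]].
have [[hg _] hh] := gt_max h hcand (elimN eqP neh).
have [_ [h0 _] _] := hcand.
have nle : ~ le (HT h) w.
  by move=> /(candidate_le_next goodJ nw hcand); apply/eqP.
by apply: nle; apply: (wo_trans woLe (maxm _ _)) (gsupp _ gwm); rewrite setYC.
Qed.

Lemma last_letter_nbrs a w : nbrs T a w -> last_letter w = ltr a.
Proof. by case. Qed.

(** The flip h of [g w] reduces by an element r of the trace to the transversal of J, so [phi] sends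
    h to h - r. This is nonzero: otherwise h, and with it [g w], would lie in J, although [g w] is
    supported on the transversal of J. The scalar c inverts the head coefficient. *)
Lemma secondP J w a : edge_generated J -> next J w -> nbrs T a w ->
  exists c r, [/\ c != 0, trace J (linv a) r,
    second le J (g w) = c *: (g w * of_group K (ltr (linv a)) - r),
    is_monic le (second le J (g w)) &
    supported_on (second le J (g w)) (words J)].
Proof.
move=> goodJ nw aw; have [idealJ JI _] := goodJ; have [HTw gww] := g_HT aw.1.
have sJ := right_ideal_subspace idealJ; have [J0 _ JM] := idealJ.
set h := g w * of_group K (ltr (linv a)).
have Vh : edge_space (linv a) h by apply/edge_space_flip/g_edge.
have [r Jr hr] := stage_reduce goodJ Vh.
have phiE : phi le J h = h - r.
  apply: xget_unique; rewrite (stage_transversal goodJ).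
    split=> //; rewrite /ideal_coset /= addrC addKr -sub0r.
    by apply: subspaceB => //; case: Jr.
  move=> k [Jkh Tk]; apply/eqP; rewrite -subr_eq0; apply/eqP.
  apply: (stage_words0 goodJ);
    last exact: subspaceB (supported_subspace K _) Tk hr.
  by rewrite opprB addrCA addrC; apply: subspaceD => //; case: Jr.
have secondE : second le J (g w) = (HC le (h - r))^-1 *: (h - r).
  by rewrite /second /monic_multiple /HTT HTw (last_letter_nbrs aw) ltrV -/h
    phiE.
have hr0 : h - r != 0.
  apply/negP; rewrite subr_eq0 => /eqP hE; have [Jr' _] := Jr.
  have Jg : J (g w).
    have <- : h * of_group K (ltr a) = g w by rewrite /h -ltrV;
      apply: of_groupVK.
    by rewrite hE; apply: JM.
  have [_ _] := next_candidate goodJ nw; rewrite (stage_transversal goodJ).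
  by move/(stage_words0 goodJ Jg)/eqP; rewrite (negPf (g_neq0 aw.1)).
have [hrHT _] := HTP woLe hr0; have c0 : (HC le (h - r))^-1 != 0.
  by rewrite invr_neq0.
exists (HC le (h - r))^-1, r; split; [exact: c0|exact: Jr|exact: secondE| |].
  rewrite secondE; split; first by rewrite scaler_eq0 negb_or c0.
  by rewrite /HC (HTZ woLe _ c0) mcoeffZ mulVf.
by rewrite secondE; apply: (subspaceZ _ (supported_subspace K (words J))).
Qed.

Lemma second_edge J w a : edge_generated J -> next J w -> nbrs T a w ->
  edge_space (linv a) (second le J (g w)).
Proof.
move=> goodJ nw aw; have [c [r [_ [_ Vr] -> _ _]]] := secondP goodJ nw aw.
have sV := edge_space_subspace (linv a).
by apply: (subspaceZ _ sV); apply: (subspaceB sV) => //;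
  apply/edge_space_flip/g_edge.
Qed.

(** * The exposure process *)

Section Process.
Variables (W : eqType) (leW : rel W) (f : W -> A).
Hypothesis woW : well_order leW.
Local Notation stageW := (stage leW f).
Hypothesis stageP : forall x, stageW x <> I /\ is_exposed le I (stageW x) (f x).
Implicit Types (x y z : W) (X : set W).

(** By transfinite induction: if all earlier elements are of the form [g w], the stage is generated
    by elements of the edge spaces, so [exposedE] applies to it. *)
Lemma process_next x : edge_generated (stageW x) /\
  exists2 w, next (stageW x) w & f x = g w.
Proof.
elim/(wo_ind woW): x => x IHx; have goodx : edge_generated (stageW x).
  apply: right_ideal_gen_edge_generated => _ [y ltyx <-].
  have [_ [w [[Bw _] _] ->]] := IHx y ltyx.
  by have [a _ Vg] := g_edge_exists Bw; exists a.
split=> //; have [ne fex] := stageP x; have [w nw] := next_exists goodx ne.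
by exists w => //; apply/(exposedE _ goodx nw).
Qed.

Lemma process_good x : edge_generated (stageW x).
Proof. by have [] := process_next x. Qed.

Lemma process_letter x : exists w a,
  [/\ next (stageW x) w, nbrs T a w & f x = g w].
Proof.
have [_ [w nw fx]] := process_next x; have [[Bw _] _] := nw.
by have [a aw _] := g_edge_exists Bw; exists w, a.
Qed.

Lemma process_range_good : edge_generated (right_ideal_gen (range f)).
Proof.
apply: right_ideal_gen_edge_generated => _ [x _ <-].
by have [w [a [_ aw ->]]] := process_letter x; exists a => //; apply: g_edge.
Qed.

Local Notation s x := (second le (stageW x) (f x)).

Definition outputs X : set A := [set q | exists2 x, X x & q = f x \/ q = s x].

Lemma process_HTT x : exists w a, [/\ next (stageW x) w, nbrs T a w, f x = g w,
  nbrs T a (HT (f x)) & nbrs T (linv a) (HT (s x))].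
Proof.
have [w [a [nw aw fx]]] := process_letter x; have goodx := process_good x.
exists w, a; split=> //; rewrite fx; first by rewrite (g_HT aw.1).1.
apply: (edge_space_HT (second_edge goodx nw aw)).
by have [c [r [_ _ _ [] //]]] := secondP goodx nw aw.
Qed.

Lemma outputs_edge X q : outputs X q -> exists a,
  [/\ edge_space a q, is_monic le q & nbrs T a (HT q)].
Proof.
case=> x _ qx; have [w [a [nw aw fx fHT sHT]]] := process_HTT x.
have goodx := process_good x; case: qx => ->.
  exists a; split=> //; rewrite fx; first exact: g_edge.
  by have [] := next_candidate goodx nw.
exists (linv a); split=> //; rewrite fx; first exact: second_edge.
by have [c [r [_ _ _ ? _]]] := secondP goodx nw aw.
Qed.

Lemma outputs_edge_HTT X q a : outputs X q -> HTT le q = ltr a ->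
    edge_space a q.
Proof.
move=> /outputs_edge[b [Vq _ bq]];
  rewrite /HTT (last_letter_nbrs bq) => /ltr_inj ba.
by rewrite -ba.
Qed.

Definition output_span X a : set A :=
  lin_span [set q | outputs X q /\ HTT le q = ltr a].

Lemma output_span_mono X X' a : X `<=` X' ->
    output_span X a `<=` output_span X' a.
Proof.
move=> XX'; apply: lin_span_sub; first exact: lin_span_subspace.
move=> q [[x Xx qx] qa]; apply: sub_lin_span; split=> //.
by exists x => //; apply: XX'.
Qed.

Lemma output_span_edge X a : output_span X a `<=` edge_space a.
Proof.
apply: lin_span_sub; first exact: edge_space_subspace.
by move=> q [qX qa]; apply: outputs_edge_HTT qX qa.
Qed.

(** The spans of outputs form a flip-stable family, whose ideal meets the edge spaces in the spans
    alone. Stability comes from the relation s_x = k (f_x c^-1 - t), read in both directions: the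
    flips of f_x and s_x are each other up to scalars and up to t or t c, which lie in traces of the
    stage at x and hence, by hypothesis, in spans of earlier outputs. *)
Lemma trace_output_span_step X :
  (forall x, X x -> [set y | wo_lt leW y x] `<=` X) ->
  (forall x a, X x ->
     trace (stageW x) a `<=` output_span [set y | wo_lt leW y x] a) ->
  forall a, trace (right_ideal_gen (f @` X)) a `<=` output_span X a.
Proof.
move=> downX IHX a r [Jr Vr].
have spanS b := lin_span_subspace [set q | outputs X q /\ HTT le q = ltr b].
have flip b q : output_span X b q ->
    output_span X (linv b) (q * of_group K (ltr (linv b))).
  move: q; apply: (lin_span_sub (subspace_mulr (of_group K (ltr (linv b)))
    (spanS (linv b)))).
  move=> q [[x Xx qx] qb] /=; have goodx := process_good x.
  have [w [c [nw cw fx fHT sHT]]] := process_HTT x.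
  have [k [t [k0 Jt sE _ _]]] := secondP goodx nw cw; rewrite -fx in sE.
  case: qx => qE.
    have bc : b = c.
      by apply: ltr_inj; rewrite -qb qE /HTT (last_letter_nbrs fHT).
    rewrite qE bc; have -> : f x * of_group K (ltr (linv c)) = k^-1 *: s x + t.
      by rewrite sE scalerA (mulVf k0) scale1r subrK.
    have [_ sD] := spanS (linv c); apply: sD.
      apply: sub_lin_span; split; first by exists x;
        [exact: Xx|exact: or_intror erefl].
      by rewrite /HTT (last_letter_nbrs sHT).
    exact: (output_span_mono (downX x Xx) (IHX x _ Xx t Jt)).
  have bc : b = linv c.
    by apply: ltr_inj; rewrite -qb qE /HTT (last_letter_nbrs sHT).
  rewrite qE bc linvK; have tc := trace_flip goodx Jt; rewrite linvK in tc.
  have -> : s x * of_group K (ltr c) = k *: (f x - t * of_group K (ltr c)).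
    have fK : f x * of_group K (ltr (linv c)) * of_group K (ltr c) = f x.
      by rewrite -ltrV; apply: of_groupVK.
    rewrite sE -ga_scaleAl mulrBl fK; reflexivity.
  apply: (subspaceZ _ (spanS c)); apply: (subspaceB (spanS c)).
    apply: sub_lin_span; split; first by exists x; [exact: Xx|left].
    by rewrite /HTT (last_letter_nbrs fHT).
  exact: (output_span_mono (downX x Xx) (IHX x _ Xx _ tc)).
apply: (generated_ideal_edge_space spanS (@output_span_edge X) flip) => //.
apply: right_ideal_gen_sub Jr; first exact: right_ideal_gen_ideal.
move=> _ [x Xx <-]; have [w [c [_ _ _ fHT _]]] := process_HTT x.
apply: sub_right_ideal_gen; exists c => //; apply: sub_lin_span; split.
  by exists x; [exact: Xx|left].
by rewrite /HTT (last_letter_nbrs fHT).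
Qed.

Lemma trace_stage_output_span x a :
  trace (stageW x) a `<=` output_span [set y | wo_lt leW y x] a.
Proof.
elim/(wo_ind woW): x a => x IHx a;
  apply: trace_output_span_step => [y ltyx z ltzy|y b ltyx].
  exact: wo_lt_trans ltzy ltyx.
exact: IHx.
Qed.

Lemma trace_range_output_span a :
  trace (right_ideal_gen (range f)) a `<=` output_span setT a.
Proof.
apply: trace_output_span_step => // x b _.
exact: trace_stage_output_span.
Qed.

(** An output has no word with a prefix among the heads of its own stage, while its own head is one
    of the heads of every later stage. This is what separates outputs. *)
Lemma output_stage x q : q = f x \/ q = s x ->
  supported_on q (words (stageW x)) /\
  forall y, wo_lt leW x y -> exists a, trace (stageW y) a q.
Proof.
have goodx := process_good x; have [w [a [nw aw fx]]] := process_letter x.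
have Jf y : wo_lt leW x y -> stageW y (f x).
  by move=> ltxy; apply: sub_right_ideal_gen; exists x.
have [c [r [_ [Jr Vr] sE _ Ts]]] := secondP goodx nw aw; rewrite -fx in sE Ts.
have [_ _] := next_candidate goodx nw; rewrite (stage_transversal goodx) => Tg.
case=> ->; split=> [|y ltxy]; first by rewrite fx.
- by exists a; split; [exact: Jf|rewrite fx; apply: g_edge].
- exact: Ts.
exists (linv a); split; last by rewrite fx; apply: second_edge.
have [idealy _ _] := process_good y; have sy := right_ideal_subspace idealy.
rewrite sE; apply: (subspaceZ _ sy); apply: (subspaceB sy).
  by have [_ _ JM] := idealy; apply: JM (Jf y ltxy).
move: Jr; apply: (right_ideal_gen_sub idealy) => _ [z ltzx <-].
by apply: sub_right_ideal_gen; exists z; first exact: wo_lt_trans ltzx ltxy.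
Qed.

(** Outputs of different indices are separated by [output_stage]. The two outputs of one index have
    heads ending in mutually inverse letters, which are never equal. *)
Lemma outputs_HT_inj q1 q2 : outputs setT q1 -> outputs setT q2 ->
  HT q1 = HT q2 -> q1 = q2.
Proof.
move=> out1 out2 HT12; case: (out1) (out2) => [x _ qx] [y _ qy].
have [_ [_ [q10 _] _]] := outputs_edge out1;
  have [_ [_ [q20 _] _]] := outputs_edge out2.
have ne z t p p' : wo_lt leW z t -> p = f z \/ p = s z ->
  p' = f t \/ p' = s t ->
    p != 0 -> p' != 0 -> HT p = HT p' -> False.
  move=> ltzt /output_stage[_ /(_ t ltzt)[a Jp]] /output_stage[Tp' _] p0 p'0 pE.
  by apply: (trace_HT_notin Jp p0); rewrite pE;
    apply: (HT_support woLe p'0 Tp').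
have [ltxy|exy|ltyx] := wo_ltgt woW x y.
- by case: (ne x y q1 q2).
- rewrite -exy in qy; have [w [a [_ _ _ fHT sHT]]] := process_HTT x.
  have eqa : a = linv a -> False by apply/nesym/eqP/linv_neq.
  case: qx qy HT12 => -> [] -> // HT12; exfalso; apply: eqa.
    by rewrite HT12 in fHT; apply: nbrs_disjoint fHT sHT.
  by rewrite -HT12 in fHT; apply: nbrs_disjoint fHT sHT.
by case: (ne y x q2 q1).
Qed.

Lemma process_inj x y : f x = f y -> x = y.
Proof.
have lt_neq z t : wo_lt leW z t -> f z <> f t.
  move=> ltzt fzt; have [|_ /(_ t ltzt)[a Jf]] := @output_stage z (f z);
    first by left.
  have [|Tf _] := @output_stage t (f t); first by left.
  have [w [b [_ bw ft]]] := process_letter t; rewrite fzt in Jf.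
  have f0 : f t != 0 by rewrite ft; apply: g_neq0 bw.1.
  by apply: (trace_HT_notin Jf f0); apply: (HT_support woLe f0 Tf).
move=> fxy; have [/lt_neq|//|/lt_neq] := wo_ltgt woW x y; first by rewrite fxy.
by rewrite fxy.
Qed.

(** * The outputs of a complete process form a CRS *)

Hypothesis rangeI : right_ideal_gen (range f) = I.

(** For a prefix-neighbor v of T, [g v] is a combination of outputs, so its head v is the head of an
    output. Conversely all heads of outputs are prefix-neighbors of T. *)
Lemma outputs_T_HT : T_HT le (outputs setT) = T.
Proof.
apply/seteqP; split=> w.
  move=> Qw; apply: contrapT => /(notin_prefix_neighbor pcT)[v Bv vw].
  have [a av Vg] := g_edge_exists Bv.
  have : output_span setT a (g v).
    by apply: trace_range_output_span; rewrite rangeI; split=> //; case: Vg.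
  move=> /(HT_lin_span woLe)[|||q [qQ _]].
  - by move=> q [/outputs_edge[_ [_ [] //]]].
  - by move=> q1 q2 [q1Q _] [q2Q _]; apply: outputs_HT_inj.
  - exact: g_neq0.
  by rewrite (g_HT Bv).1 => vE; have := Qw q qQ; rewrite -vE vw.
move=> Tw q /outputs_edge[a [_ _ [[nTq _] _]]]; apply/negP => qw.
by apply: nTq; apply: pcT qw Tw.
Qed.

Lemma outputs_CRS : is_CRS_for le I (outputs setT).
Proof.
split; last first.
  apply/seteqP; split.
    apply: right_ideal_gen_sub => // q /outputs_edge[a [[Iq _] _ _]]; exact: Iq.
  rewrite -{1}rangeI; apply: right_ideal_gen_sub;
    first exact: right_ideal_gen_ideal.
  by move=> _ [x _ <-]; apply: sub_right_ideal_gen; exists x; [|left].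
split=> [q qQ|q1 q2|q qQ|q qQ].
(* A constant would have head 1, which lies in T, whereas heads of outputs do not. *)
- have [a [_ monq [Bq _]]] := outputs_edge qQ; split=> // -[c qE].
  have [qHT _] := HTP woLe monq.1; have [nTq _] := Bq; apply: nTq.
  suff -> : HT q = 1%g by [].
  have q0 u : u != 1%g -> q@_u = 0.
    by move=> ne; rewrite qE mcoeffZ of_group_coeff eq_sym (negPf ne) mulr0.
  by apply/eqP; apply: contraNT qHT => /q0 ->.
- exact: outputs_HT_inj.
- have [a [Vq _ aq]] := outputs_edge qQ.
  rewrite /HTT (last_letter_nbrs aq) ltrV.
  apply: trace_range_output_span; rewrite rangeI; split;
    last exact: edge_space_flip.
  by have [_ _ IM] := idealI; apply: IM; case: Vq.
rewrite outputs_T_HT; have [a [[_ Tq] _ _]] := outputs_edge qQ.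
by apply: supported_sub Tq => u [Tu|[Bu _]]; [left|right].
Qed.

End Process.

(** * Uniqueness and existence of the process *)

Lemma next_unique J v w : next J v -> next J w -> v = w.
Proof.
by move=> [Jv minv] [Jw minw]; apply: (wo_anti woLe); [apply: minv|apply: minw].
Qed.

Definition below (W : eqType) (leW : rel W) (x : W) : set W :=
  [set y | wo_lt leW y x].

Lemma process_below_eq (W W' : eqType) (leW : rel W) (leW' : rel W')
    (f : W -> A) (f' : W' -> A) x x' :
  exposure_process le I leW f -> exposure_process le I leW' f' ->
  f @` below leW x = f' @` below leW' x' ->
  stage leW f x = stage leW' f' x' /\ f x = f' x'.
Proof.
move=> [woW stageP _] [woW' stageP' _] eq_below.
have eq_stage : stage leW f x = stage leW' f' x' by congr right_ideal_gen.
split=> //; have [_ [w nw ->]] := process_next woW stageP x.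
have [_ [w' nw' ->]] := process_next woW' stageP' x'.
by rewrite (next_unique nw (w := w')) // eq_stage.
Qed.

(** Comparison of two processes by transfinite induction. X' collects the positions of the second
    process already matched by some y below x, and x' is the least unmatched one. It exists, since
    otherwise the stage at x would contain the whole second process and equal I. *)
Lemma process_simulation (W W' : eqType) (leW : rel W) (leW' : rel W')
    (f : W -> A) (f' : W' -> A) x :
  exposure_process le I leW f -> exposure_process le I leW' f' ->
  exists x', f @` below leW x = f' @` below leW' x'.
Proof.
move=> procf procf'; have [woW stageP _] := procf;
  have [woW' stageP' rangeI'] := procf'.
elim/(wo_ind woW): x => x IHx.
pose X' := [set y' | exists2 y,
  wo_lt leW y x & f @` below leW y = f' @` below leW' y'].
have fX' y' : X' y' -> exists2 y, wo_lt leW y x & f y = f' y'.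
  by move=> [y ltyx /(process_below_eq procf procf')[_ fy]]; exists y.
have [|x' nX' minx'] := wo_min woW' (X := ~` X').
  apply: contrapT => /set0P/negP; rewrite negbK => /eqP E.
  have [neI _] := stageP x; apply: neI; apply/seteqP; split.
    by have [[]] := process_good woW stageP x.
  rewrite -{1}rangeI'; apply: right_ideal_gen_sub;
    first exact: right_ideal_gen_ideal.
  move=> _ [y' _ <-]; have [|y ltyx <-] := fX' y'.
    by apply: contrapT => nX'; have : (~` X') y' by []; rewrite E.
  by apply: sub_right_ideal_gen; exists y.
exists x'; apply/seteqP; split=> _ [y lty <-]; last first.
  have [|z ltzx <-] := fX' y; last by exists z.
  by apply: contrapT => /minx'; apply/(wo_ltNge woW').
have [y' E] := IHx y lty; have [_ fy] := process_below_eq procf procf' E.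
exists y' => //; have [//|y'x'|ltx'y'] := wo_ltgt woW' y' x'.
  by case: nX'; exists y; rewrite -?y'x'.
(* If x' came before y', its element would equal f z for some z below y; as the second process is
   injective, the position matching z is x' itself, so x' would be matched. *)
case: nX'; have : (f' @` below leW' y') (f' x') by exists x'.
rewrite -E => -[z ltzy fz]; have ltzx := wo_lt_trans woW ltzy lty.
have [z' Ez] := IHx z ltzx; have [_ fz'] := process_below_eq procf procf' Ez.
exists z => //; rewrite Ez; congr (f' @` below leW' _).
by apply: (process_inj woW' stageP'); rewrite -fz' fz.
Qed.

Lemma groebner_basisE (W : eqType) (leW : rel W) (f : W -> A) :
  exposure_process le I leW f -> groebner_basis le I = outputs leW f setT.
Proof.
move=> procf; apply/seteqP; split=> q.
  move=> [W' [leW' [f' [procf' [x qx]]]]].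
  have [x' E] := process_simulation x procf' procf.
  have [Est Ef] := process_below_eq procf' procf E.
  by exists x'; [|rewrite -Est -Ef; exact: qx].
by move=> [x _ qx]; exists W, leW, f; split=> //; exists x.
Qed.

(* The process is indexed by the heads of its elements: w is such a head when *)
(* g w is exposed after the g u for the smaller heads u.                      *)
Lemma exposure_process_exists : exists (W : eqType) (leW : rel W) (f : W -> A),
  exposure_process le I leW f.
Proof.
have [X XE] := wo_rec woLe (fun w Y => [/\ prefix_neighbors T w,
  right_ideal_gen (g @` Y) <> I &
  is_exposed le I (right_ideal_gen (g @` Y)) (g w)]).
pose W : eqType := {w : F | `[< X w >]}; pose leW : rel W := relpre val le.
pose f (x : W) := g (val x).
have XP (x : W) : X (val x) by apply/asboolP; case: x.
have woW : well_order leW.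
  move=> Y [y Yy].
  have [|w [v Yv vw] minw] := wo_min woLe (X := val @` [set` Y]).
    by exists (val y), y.
  exists v; split=> [|v' [Yv' minv']].
    split=> // z Yz; rewrite /leW /= vw; apply: minw; by exists z.
  apply: val_inj; apply: (wo_anti woLe); last exact: minv'.
  by rewrite vw; apply: minw; exists v'.
have stageE x : stage leW f x =
    right_ideal_gen (g @` [set u | X u /\ wo_lt le u (val x)]).
  congr right_ideal_gen; apply/seteqP; split=> h [].
    move=> y [leyx neyx] <-; exists (val y) => //; split; first exact: XP.
    by split=> // E; apply/neyx/val_inj.
  move=> u [Xu0 [leux neux]] <-; have /asboolP Xu := Xu0.
  exists (exist _ u Xu : W) => //; split=> // E; apply: neux.
  by rewrite -E.
have stageP x : stage leW f x <> I /\ is_exposed le I (stage leW f x) (f x).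
  by rewrite stageE; have [] := (XE _).1 (XP x).
(* Suppose the process ends with J smaller than I. The next word w is not in X, because [g w] is not
   in J; but w lies above all of X, so the elements before w generate exactly J and the recursion
   would have put w into X. *)
exists W, leW, f; split=> //; apply: contrapT => JneI.
set J := right_ideal_gen _ in JneI.
have goodJ : edge_generated J := process_range_good woW stageP.
have [w nw] := next_exists goodJ JneI; have [[Bw Jw] _] := nw.
have Jg u : X u -> J (g u).
  move=> /asboolP Xu; apply: sub_right_ideal_gen.
  by exists (exist _ u Xu : W).
have nXw : ~ X w.
  move=> /Jg Jgw; have [a aw Vg] := g_edge_exists Bw.
  have := trace_HT_notin (conj Jgw Vg) (g_neq0 Bw); apply.
  by rewrite (g_HT Bw).1.
have ltw u : X u -> wo_lt le u w.
  move=> Xu; have [//|uw|ltwu] := wo_ltgt woLe u w; first by rewrite uw in Xu.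
  have /asboolP Xu' := Xu; pose x : W := exist _ u Xu'.
  have [_ [v nv fx]] := process_next woW stageP x.
  have vu : v = u.
    have [[Bv _] _] := nv; have [Bu _ _] := (XE u).1 Xu.
    by rewrite -(g_HT Bv).1 -fx (g_HT Bu).1.
  have subJ : stage leW f x `<=` J.
    apply: right_ideal_gen_sub; first exact: right_ideal_gen_ideal.
    by move=> _ [y _ <-]; apply: sub_right_ideal_gen; exists y.
  have := (nv.2 w (conj Bw (stage_words_mono subJ Jw))); rewrite vu.
  by have /(wo_ltNge woLe) := ltwu.
apply: nXw; apply/XE; have -> : [set u | X u /\ wo_lt le u w] = X.
  apply/seteqP; split=> u; first by case.
  by move=> Xu; split; last exact: ltw.
have -> : g @` X = range f.
  apply/seteqP; split=> h [].
    by move=> u /asboolP Xu <-; exists (exist _ u Xu : W).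
  by move=> x _ <-; exists (val x).
by split=> //; apply/(exposedE _ goodJ nw).
Qed.

End IdealFromNeighbors.

Theorem theorem1p6 (K : fieldType) (S : finType) (le : rel (free_group S))
    (I : set (group_algebra K (free_group S))) :
  exposure_order le -> right_ideal I -> I <> setT ->
  is_CRS_for le I (groebner_basis le I).
Proof.
move=> [woLe preLe] idealI properI.
have [T [[pcT SpT _] _] redT] := min_transversal_exists woLe preLe idealI.
have IT0 f : I f -> supported_on f T -> f = 0.
  move=> If Tf; have : (Sp K T `&` I) f by split; first by rewrite SpE.
  by rewrite SpT.
(* Otherwise 1 is a prefix-neighbor of T and is congruent modulo I to a combination of words below
   1. The empty word is a prefix of every word, so there are none, and 1 would lie in I. *)
have T1 : T 1%g.
  apply: contrapT => /neighbor1 /redT[h h1 Ih]; apply: properI.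
  have h0 : h = 0.
    apply/eqP/negPn/negP => /(HT_support woLe) /(_ h1)[_].
    by move=> /(wo_ltNge woLe); apply; apply: preLe; rewrite prefix0s.
  apply/seteqP; split=> // f _; have [_ _ IM] := idealI.
  by rewrite h0 subr0 in Ih; rewrite -[f]mul1r; apply: IM.
have [|g gP] := @choice (free_group S) (group_algebra K (free_group S))
  (fun w q => prefix_neighbors T w ->
     I q /\ supported_on (q - of_group K w) [set u | T u /\ wo_lt le u w]).
  move=> w; have [Bw|nBw] := pselect (prefix_neighbors T w); last by exists 0.
  have [h Th Ih] := redT w Bw; exists (of_group K w - h) => _; split;
    first exact: Ih.
  have [supp0 _] := supported_subspace K [set u | T u /\ wo_lt le u w].
  rewrite [X in supported_on X]addrAC subrr.
  exact: (subspaceB (supported_subspace K _) supp0 Th).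
have [W [leW [f procf]]] :=
  exposure_process_exists woLe preLe idealI pcT T1 IT0 redT gP.
rewrite (groebner_basisE woLe preLe idealI pcT T1 IT0 redT gP procf).
have [woW stageP rangeI] := procf.
exact: (outputs_CRS woLe preLe idealI pcT T1 IT0 redT gP woW stageP rangeI).
Qed.
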